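(* In the homogeneous setting described in the context, the squared norm of the Nijenhuis tensor $N$ of $J$ is the constant $$|N|^2=\frac18\sum_{i,j=1}^{2n}\left|[e_i,e_j]_{\mathfrak m}\right|^2+\frac14\sum_{i=1}^{2n}\mathrm{tr}(\mathrm{ad}_{e_i}^2)-\frac12\mathrm{tr}(H\,\mathrm{ad}_\xi),$$ where $\{e_1,\dots,e_{2n}\}$ is any orthonormal basis of $\mathfrak m$.
   Context: Setting: $(M,\omega)$ is a connected symplectic manifold of dimension $2n$ with a compatible almost complex structure $J$ (i.e. $J^2=-\mathrm{id}$, $\omega(J\cdot,J\cdot)=\omega$, $\omega(v,Jv)>0$ for $v\ne0$), and $g(u,v)=\omega(u,Jv)$. A connected Lie group $G$ acts transitively on $M$ preserving $\omega$ and $J$, almost effectively (no non-discrete normal subgroup of $G$ acts trivially). Fix $x\in M$ with isotropy subgroup $K\subset G$, taken to be compact. Let $\mathfrak g,\mathfrak k$ be the Lie algebras of $G,K$, with bracket $[\cdot,\cdot]_{\mathfrak g}$ and $\mathrm{ad}_X(Y)=[X,Y]_{\mathfrak g}$. Fix an $\mathrm{Ad}_K$-invariant complement $\mathfrak m$, $\mathfrak g=\mathfrak k\oplus\mathfrak m$; $[X,Y]_{\mathfrak m}$ is the $\mathfrak m$-component of $[X,Y]_{\mathfrak g}$. Each $X\in\mathfrak g$ induces the vector field on $M$ generating $z\mapsto e^{tX}z$; evaluation at $x$ gives an isomorphism $\mathfrak m\cong T_xM$, through which $\omega_x,J_x,g_x$ define a symplectic form $\sigma$, a complex structure $H$ and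 a scalar product $\langle X,Y\rangle=\sigma(X,HY)$ on $\mathfrak m$. $H$ is extended to $\mathfrak g$ by $H\mathfrak k=\{0\}$; traces are of endomorphisms of $\mathfrak g$. The element $\xi\in\mathfrak g$ is $\xi=\sum_{i=1}^n[f_i,f_{i+n}]_{\mathfrak g}$ for any symplectic basis $\{f_i\}$ of $(\mathfrak m,\sigma)$ ($\sigma(f_i,f_{i+n})=1$, other pairings with $i<j$ zero); it is independent of the basis. The Nijenhuis tensor is $4N(X,Y)=[JX,JY]-J[JX,Y]-J[X,JY]-[X,Y]$, a $TM$-valued two-form, with norm $|N|^2=\sum_{i<j}|N(\epsilon_i,\epsilon_j)|_g^2$ for a local $g$-orthonormal frame $\{\epsilon_i\}$. *)

(* Defs.v *)
From HB Require Import structures.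
From mathcomp Require Import all_boot all_order all_algebra.
From mathcomp Require Import all_classical all_reals all_analysis.

Set Implicit Arguments.
Unset Strict Implicit.
Unset Printing Implicit Defensive.

Import Order.TTheory GRing.Theory Num.Theory numFieldNormedType.Exports.

Local Open Scope classical_set_scope.
Local Open Scope ring_scope.

(* Meant for an open set A of a finite-dimensional V, where this is the usual
   notion of a C^k map on A. *)
Fixpoint Ck (R : realType) (V W : normedModType R) (k : nat)
    (A : set V) (f : V -> W) : Prop :=
  if k is k'.+1 then
    (forall u, A u -> differentiable f u) /\
    (forall v, Ck k' A (fun u => 'D_v f u))
  else forall u, A u -> {for u, continuous f}.

Definition smooth_on (R : realType) (V W : normedModType R)
  (A : set V) (f : V -> W) : Prop := forall k, Ck k A f.

(* The atlas is indexed by the points of the manifold: chart p, with domain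
   cdom p and inverse cinv p, is a chosen chart around p (the choice of p is
   not required to depend on p in any regular way).  chart p and cinv p are
   total functions, irrelevant outside cdom p and chart p @` cdom p. *)
Record manifold (R : realType) (d : nat) := Manifold {
  mpoint :> topologicalType;
  chart : mpoint -> mpoint -> 'rV[R]_d;
  cdom : mpoint -> set mpoint;
  cinv : mpoint -> 'rV[R]_d -> mpoint;
  manifold_hausdorff : hausdorff_space mpoint;
  manifold_second_countable : @second_countable mpoint;
  cdom_center : forall p, cdom p p;
  cdom_open : forall p, open (cdom p);
  chart_image_open : forall p, open (chart p @` cdom p);
  chartK : forall p z, cdom p z -> cinv p (chart p z) = z;
  chart_continuous : forall p z, cdom p z -> {for z, continuous (chart p)};
  cinv_continuous : forall p u, (chart p @` cdom p) u ->
    {for u, continuous (cinv p)};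
  chart_transition : forall p q,
    smooth_on (chart p @` (cdom p `&` cdom q)) (chart q \o cinv p)
}.

Section Manifolds.
Context {R : realType}.

Definition smooth_map d1 d2 (M : manifold R d1) (N : manifold R d2)
    (f : M -> N) : Prop :=
  continuous f /\
  forall p q, smooth_on (chart p @` (cdom p `&` f @^-1` cdom q))
                        (chart q \o f \o cinv p).

(* Smoothness on the product manifold M1 x M2, with the product charts. *)
Definition smooth_map2 d1 d2 d3 (M1 : manifold R d1) (M2 : manifold R d2)
    (N : manifold R d3) (f : M1 -> M2 -> N) : Prop :=
  continuous (fun z : M1 * M2 => f z.1 z.2) /\
  forall p q o,
    smooth_on [set w : 'rV[R]_(d1 + d2) |
                 [/\ (chart p @` cdom p) (lsubmx w),
                     (chart q @` cdom q) (rsubmx w) &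
                     cdom o (f (cinv p (lsubmx w)) (cinv q (rsubmx w)))]]
              (fun w => chart o (f (cinv p (lsubmx w)) (cinv q (rsubmx w)))).

Definition smooth_curve d (M : manifold R d) (c : R -> M) : Prop :=
  continuous c /\
  forall p, smooth_on (c @^-1` cdom p : set R^o) (fun t : R^o => chart p (c t)).

Definition smooth_fun d (M : manifold R d) (U : set M) (f : M -> R) : Prop :=
  forall p, smooth_on (chart p @` (U `&` cdom p)) (f \o cinv p : _ -> R^o).

(* The tangent space at z is 'rV_d, a tangent vector being given by its
   components in the chart centered at z.  Accordingly the differential of f at
   z is read in the charts chart z and chart (f z). *)
Definition tmap d1 d2 (M : manifold R d1) (N : manifold R d2)
    (f : M -> N) (z : M) : {linear 'rV[R]_d1 -> 'rV[R]_d2} :=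
  'd (chart (f z) \o f \o cinv z) (chart z z).

Section VectorFields.
Context {d : nat} {M : manifold R d}.
Implicit Types (X Y Z : M -> 'rV[R]_d) (f : M -> R) (U : set M).

(* The components of X in the chart indexed by p. *)
Definition vfield_in p X (u : 'rV[R]_d) : 'rV[R]_d :=
  let z := cinv p u in 'd (chart p \o cinv z) (chart z z) (X z).

Definition smooth_vfield U X : Prop :=
  forall p, smooth_on (chart p @` (U `&` cdom p)) (vfield_in p X).

Definition vderiv X f (z : M) : R :=
  'd (f \o cinv z : 'rV[R]_d -> R^o) (chart z z) (X z).

Definition vbracket X Y (z : M) : 'rV[R]_d :=
  'd (vfield_in z Y) (chart z z) (X z) - 'd (vfield_in z X) (chart z z) (Y z).

Definition two_form := M -> {biscalar 'rV[R]_d}.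

Definition closed_form (w : two_form) : Prop :=
  forall U X Y Z, open U ->
    smooth_vfield U X -> smooth_vfield U Y -> smooth_vfield U Z ->
    forall z, U z ->
      vderiv X (fun y => w y (Y y) (Z y)) z
    + vderiv Y (fun y => w y (Z y) (X y)) z
    + vderiv Z (fun y => w y (X y) (Y y)) z
    - w z (vbracket X Y z) (Z z)
    - w z (vbracket Y Z z) (X z)
    - w z (vbracket Z X z) (Y z) = 0.

Definition symplectic (w : two_form) : Prop :=
  [/\ forall U X Y, open U -> smooth_vfield U X -> smooth_vfield U Y ->
        smooth_fun U (fun z => w z (X z) (Y z)),
      forall z u, w z u u = 0,
      forall z u, (forall v, w z u v = 0) -> u = 0 &
      closed_form w].

Definition endo_field := M -> {linear 'rV[R]_d -> 'rV[R]_d}.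

Definition almost_complex (J : endo_field) : Prop :=
  (forall U X, open U -> smooth_vfield U X ->
     smooth_vfield U (fun z => J z (X z))) /\
  (forall z u, J z (J z u) = - u).

Definition compatible (w : two_form) (J : endo_field) : Prop :=
  (forall z u v, w z (J z u) (J z v) = w z u v) /\
  (forall z u, u != 0 -> 0 < w z u (J z u)).

Definition metric (w : two_form) (J : endo_field) (z : M) (u v : 'rV[R]_d) : R :=
  w z u (J z v).

Definition nijenhuis (J : endo_field) X Y (z : M) : 'rV[R]_d :=
  let JX := fun y => J y (X y) in
  let JY := fun y => J y (Y y) in
  4^-1 *: (vbracket JX JY z - J z (vbracket JX Y z) - J z (vbracket X JY z)
           - vbracket X Y z).

Definition local_orthonormal_frame (w : two_form) (J : endo_field)
    (U : set M) (eps : 'I_d -> M -> 'rV[R]_d) : Prop :=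
  (forall i, smooth_vfield U (eps i)) /\
  (forall z, U z -> forall i j, metric w J z (eps i z) (eps j z) = (i == j)%:R).

Definition nijenhuis_norm2 (w : two_form) (J : endo_field)
    (eps : 'I_d -> M -> 'rV[R]_d) (z : M) : R :=
  \sum_(i < d) \sum_(j < d | (i < j)%N)
    (let Nij := nijenhuis J (eps i) (eps j) z in metric w J z Nij Nij).

End VectorFields.
End Manifolds.

Arguments two_form {R d} M.
Arguments endo_field {R d} M.

Record lieGroup (R : realType) (r : nat) := LieGroup {
  lmanifold :> manifold R r;
  lmul : lmanifold -> lmanifold -> lmanifold;
  linv : lmanifold -> lmanifold;
  lone : lmanifold;
  lmulA : forall a b c, lmul a (lmul b c) = lmul (lmul a b) c;
  lmul1g : forall a, lmul lone a = a;
  lmulg1 : forall a, lmul a lone = a;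
  lmulVg : forall a, lmul (linv a) a = lone;
  lmulgV : forall a, lmul a (linv a) = lone;
  lmul_smooth : smooth_map2 lmul;
  linv_smooth : smooth_map linv
}.

Arguments lone {R r} _.

Section LieGroups.
Context {R : realType} {r : nat} (G : lieGroup R r).

(* The Lie algebra is the tangent space at the identity, 'rV_r, with the bracket
   of left-invariant vector fields. *)
Definition left_invariant (X : 'rV[R]_r) (a : G) : 'rV[R]_r :=
  tmap (lmul a) (lone G) X.

Definition lie (X Y : 'rV[R]_r) : 'rV[R]_r :=
  vbracket (left_invariant X) (left_invariant Y) (lone G).

Definition Ad (a : G) (X : 'rV[R]_r) : 'rV[R]_r :=
  tmap (fun b => lmul (lmul a b) (linv a)) (lone G) X.

(* ex is the exponential map: t |-> ex (t *: X) is the one-parameter subgroup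
   with initial velocity X, which determines ex. *)
Definition is_exponential (ex : 'rV[R]_r -> G) : Prop :=
  forall X,
    [/\ smooth_curve (fun t => ex (t *: X)),
        forall s t, ex ((s + t) *: X) = lmul (ex (s *: X)) (ex (t *: X)) &
        'D_1 (fun t : R^o => chart (lone G) (ex (t *: X))) (0 : R^o) = X].

Definition normal_subgroup (S : set G) : Prop :=
  [/\ S (lone G),
      forall a b, S a -> S b -> S (lmul a b),
      forall a, S a -> S (linv a) &
      forall a b, S b -> S (lmul (lmul a b) (linv a))].

Definition endo_trace (F : 'rV[R]_r -> 'rV[R]_r) : R := \tr (lin1_mx F).

End LieGroups.

Section Actions.
Context {R : realType} {r d : nat} {G : lieGroup R r} {M : manifold R d}.
Implicit Types (act : G -> M -> M) (ex : 'rV[R]_r -> G) (w : two_form M).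

Definition smooth_action act : Prop :=
  [/\ smooth_map2 act,
      forall z, act (lone G) z = z &
      forall a b z, act (lmul a b) z = act a (act b z)].

Definition transitive_action act : Prop := forall y z, exists a, act a y = z.

Definition almost_effective act : Prop :=
  forall S : set G, normal_subgroup S -> (forall a z, S a -> act a z = z) ->
    isolated S = S.

Definition preserves_form act w : Prop :=
  forall a z u v, w (act a z) (tmap (act a) z u) (tmap (act a) z v) = w z u v.

Definition preserves_endo act (J : endo_field M) : Prop :=
  forall a z u, J (act a z) (tmap (act a) z u) = tmap (act a) z (J z u).

Definition isotropy act (x : M) : set G := [set a | act a x = x].

(* The value at z of the vector field generating z |-> ex (t *: X) z; here
   ex (0 *: X) z = z, so that this is a tangent vector at z. *)
Definition fundamental_field act ex (X : 'rV[R]_r) (z : M) : 'rV[R]_d :=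
  'D_1 (fun t : R^o => chart z (act (ex (t *: X)) z)) (0 : R^o).

Definition pullback_form act ex w (x : M) (X Y : 'rV[R]_r) : R :=
  w x (fundamental_field act ex X x) (fundamental_field act ex Y x).

End Actions.

(* Main.v *)
(* Let pi : G -> M, a |-> a x.  Since the data are invariant, the left-invariant
   field of X in g is carried by d pi, over the point a x, to the image under the
   differential of a of the value at x of the field of X; hence J and w lift to
   the constant objects H and sigma on left-invariant fields.  A field on M lifts
   along pi to a combination of left-invariant fields whose coefficients are
   functions on G; as brackets of pi-related fields are pi-related, the Nijenhuis
   tensor and the closedness of w, both tensorial, become algebraic:
     4 N(X, Y) = [HX, HY]_m - H [HX, Y]_m - H [X, HY]_m - [X, Y]_m,
     sigma([X, Y], Z) + sigma([Y, Z], X) + sigma([Z, X], Y) = 0.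
   No flow on M is needed.  The rest is algebra in T(X, Y, Z) = <[X, Y]_m, Z>,
   using that [k, m] is in m and that ad_u commutes with H modulo k for u in k,
   both obtained by differentiating Ad along one-parameter subgroups. *)

Require Import Defs.
From HB Require Import structures.
From mathcomp Require Import all_boot all_order all_algebra.
From mathcomp Require Import all_classical all_reals all_analysis.
From mathcomp Require Import ring lra.

Set Implicit Arguments.
Unset Strict Implicit.
Unset Printing Implicit Defensive.

Import Order.TTheory GRing.Theory Num.Theory numFieldNormedType.Exports.

Local Open Scope classical_set_scope.
Local Open Scope ring_scope.

(** * Differentials and C^k maps *)

(** Let A, C, Y be the sums over an orthonormal basis of T_ijk^2, T_ijk T_ikj and T(He_i, e_j, e_k)
    T(e_i, e_k, He_j). Closedness reduces the sum of |4N(e_i, e_j)|^2 over all i, j to 4A + 8C +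
    16Y, so |N|^2 = A/8 + C/4 + Y/2. These are contractions over m, whereas the traces are taken
    over g and also see the k-components of brackets, through K = sum_ij <[e_i, [e_i, e_j]_k], e_j>.
    One finds sum_i tr(ad_{e_i}^2) = C + 2K and tr(H ad_xi) = K - Y: with the weights 1/4 and -1/2
    the two occurrences of K cancel. On the analytic side, the obstacle is that a tangent vector at
    z is read in a chart that varies with z without any regularity. Whatever is to be differentiated
    must first be rewritten in one fixed chart, and most of the work on manifolds and groups serves
    this purpose. *)

Section Calculus.
Context {R : realType}.

Lemma is_diffI (V W : normedModType R) (f : V -> W) (x : V) :
  differentiable f x -> is_diff x f ('d f x).
Proof. by move=> fx; exact: DiffDef. Qed.

Lemma is_diff_differentiable (V W : normedModType R) (f df : V -> W) (x : V) :
  is_diff x f df -> differentiable f x.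
Proof. by case. Qed.

Lemma is_diff_val (V W : normedModType R) (f df : V -> W) (x : V) :
  is_diff x f df -> 'd f x = df :> (V -> W).
Proof. by case. Qed.

Lemma is_diffE (V W : normedModType R) (f df : V -> W) (x : V) :
  is_diff x f df -> forall h, 'd f x h = df h.
Proof. by move=> fx h; rewrite (is_diff_val fx). Qed.

(** Charts are total functions that are meaningful only on their domains, so identities between
    local expressions hold only near a point; this lemma carries differentials across them. *)
Lemma is_diff_near (V W : normedModType R) (f g : V -> W) (x : V) (df : V -> W) :
  (\near x, f x = g x) -> is_diff x f df -> is_diff x g df.
Proof.
move=> fg [dfx <-].
have fgx : f x = g x by exact: nbhs_singleton fg.
have [cf ef] := (diff_locallyP x f).1 dfx.
have eg : g \o shift x = cst (g x) + 'd f x +o_ 0 id.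
  apply/eqaddoP => e e0.
  have fg0 : \forall h \near (0 : V), f (h + x) = g (h + x).
    by move: fg; rewrite (near_shift 0) subr0.
  have := (eqaddoP _ _ _ _).1 ef _ e0; apply: filterS2 fg0 => h /= fgh.
  by rewrite !fctE /= -fgx -fgh.
have dgE : 'd g x = 'd f x :> (V -> W) by apply: diff_unique.
apply: DiffDef; last exact: dgE.
by apply/diff_locallyP; rewrite dgE; split.
Qed.

Lemma is_diff_scale (V W : normedModType R) (f df : V -> R^o) (g dg : V -> W)
    (x : V) : is_diff x f df -> is_diff x g dg ->
  is_diff x (fun y => f y *: g y) (fun h => f x *: dg h + df h *: g x).
Proof.
move=> fx gx.
have scale_lin : bilinear_for (GRing.Scale.Law.clone _ _ *:%R _)
  (GRing.Scale.Law.clone _ _ *:%R _) (@GRing.scale R W : R^o -> W -> W).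
  split=> [u'|u] a y z /=; first by rewrite scalerDl scalerA.
  by rewrite scalerDr !scalerA mulrC.
pose sM := bilinear_isBilinear.Build _ _ _ _ _ _ _ scale_lin.
pose s : {bilinear R^o -> W -> W} := HB.pack (@GRing.scale R W : R^o -> W -> W) sM.
have sc : continuous (fun p : R^o * W => s p.1 p.2) by exact: scale_continuous.
have sd : is_diff (f x, g x) (fun p : R^o * W => s p.1 p.2)
    (fun q => s (f x) q.2 + s q.1 (g x)).
  by apply: DiffDef; [exact: differentiable_bilin|rewrite diff_bilin].
exact: (is_diff_comp (is_diff_pair fx gx) sd).
Qed.

Lemma is_diff_sum (V W : normedModType R) (I : finType) (f df : I -> V -> W)
    (x : V) : (forall i, is_diff x (f i) (df i)) ->
  is_diff x (fun y => \sum_i f i y) (fun h => \sum_i df i h).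
Proof.
move=> fx.
rewrite (_ : (fun y => _) = \sum_i f i); last by apply/funext => y; rewrite fct_sumE.
rewrite (_ : (fun h => _) = \sum_i df i); last by apply/funext => y; rewrite fct_sumE.
elim/big_rec2 : _ => [|i g dg _ gx]; first exact: is_diff_cst.
exact: is_diffD.
Qed.

Lemma linear_rV_continuous d (W : normedModType R) (f : {linear 'rV[R]_d -> W}) :
  continuous f.
Proof.
have -> : (f : _ -> _) = (fun u => \sum_i u ord0 i *: f (delta_mx ord0 i)).
  apply/funext => u; rewrite [u in LHS]row_sum_delta linear_sum.
  by apply: eq_bigr => i _; rewrite linearZ.
rewrite (_ : (fun u => _) = \sum_i fun u : 'rV_d => u ord0 i *: f (delta_mx ord0 i)).
  elim/big_ind : _ => [x|g h cg ch x|i _ x]; first exact: (@cst_continuous _ _ (0:W)).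
    by apply: continuousD; [exact: cg|exact: ch].
  by apply: continuousZr_tmp; exact: coord_continuous.
by apply/funext => u; rewrite fct_sumE.
Qed.

Lemma is_diff_linear d (W : normedModType R) (f : {linear 'rV[R]_d -> W}) x :
  is_diff x f f.
Proof.
have cf := @linear_rV_continuous _ _ f.
by apply: DiffDef; [exact: linear_differentiable|exact: diff_lin].
Qed.

Lemma is_diff_coord d (V : normedModType R) (f df : V -> 'rV[R]_d) (x : V) i :
  is_diff x f df -> is_diff x (fun y => f y ord0 i : R^o) (fun h => df h ord0 i).
Proof.
move=> fx.
have cd : is_diff (f x) (fun u : 'rV[R]_d => u ord0 i : R^o)
    (fun u : 'rV[R]_d => u ord0 i).
  have clin : linear (fun u : 'rV[R]_d => u ord0 i : R^o).
    by move=> k u v; rewrite !mxE.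
  pose cM := GRing.isLinear.Build _ _ _ _ _ clin.
  pose c : {linear 'rV[R]_d -> R^o} := HB.pack (fun u : 'rV[R]_d => u ord0 i : R^o) cM.
  exact: (is_diff_linear c).
exact: (is_diff_comp fx cd).
Qed.

Lemma linear_rVE d (W : lmodType R) (f : {linear 'rV[R]_d -> W}) u :
  f u = \sum_i u ord0 i *: f (delta_mx ord0 i).
Proof.
rewrite {1}[u]row_sum_delta linear_sum.
by apply: eq_bigr => i _; rewrite linearZ.
Qed.

End Calculus.

Section CkCalculus.
Context {R : realType}.

Lemma Ck_sub (V W : normedModType R) k (A B : set V) (f : V -> W) :
  B `<=` A -> Ck k A f -> Ck k B f.
Proof.
move=> BA; elim: k f => [|k IH] f /=; first by move=> fA u /BA /fA.
by move=> [df cf]; split=> [u /BA /df//|v]; exact: IH.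
Qed.

Lemma Ck_local (V W : normedModType R) k (A : set V) (f : V -> W) :
  (forall u, A u -> exists2 B : set V, B u & Ck k B f) -> Ck k A f.
Proof.
elim: k f => [|k IH] f fA /=; first by move=> u /fA[B Bu fB]; exact: (fB u Bu).
split=> [u /fA[B Bu [fB _]]|v]; first exact: (fB u Bu).
by apply: (IH ('D_v f)) => u /fA[B Bu [_ cB]]; exists B => //; exact: cB.
Qed.

Lemma CkW (V W : normedModType R) k (A : set V) (f : V -> W) :
  Ck k.+1 A f -> Ck k A f.
Proof.
elim: k f => [|k IH] f [df cf].
  by move=> u /df; exact: differentiable_continuous.
by split=> // v; apply: IH; exact: cf.
Qed.

Lemma CkD (V W : normedModType R) k (A : set V) (f : V -> W) v :
  Ck k.+1 A f -> Ck k A ('D_v f).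
Proof. by move=> [_ cf]; exact: cf. Qed.

Lemma Ck_ext (V W : normedModType R) k (A : set V) (f g : V -> W) :
  open A -> (forall u, A u -> f u = g u) -> Ck k A f -> Ck k A g.
Proof.
move=> oA; elim: k f g => [|k IH] f g fg /=.
  move=> cf u Au; have := cf u Au; rewrite /prop_for /continuous_at -fg// => fu.
  apply: cvg_trans fu; apply: near_eq_cvg.
  by apply: filterS (open_nbhs_nbhs (conj oA Au)) => z Az; rewrite fg.
have nfg u : A u -> \forall z \near u, f z = g z.
  by move=> Au; apply: filterS (open_nbhs_nbhs (conj oA Au)) => z /fg.
move=> [df cf]; split=> [u Au|v].
  exact: is_diff_differentiable (is_diff_near (nfg _ Au) (is_diffI (df u Au))).
by apply: (IH ('D_v f)) => // u Au; exact: near_eq_derive (nfg _ Au).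
Qed.

Lemma is_diff_derive (V W : normedModType R) (f df : V -> W) u v :
  is_diff u f df -> 'D_v f u = df v.
Proof. by move=> fu; rewrite deriveE ?diff_val//; exact: is_diff_differentiable fu. Qed.

Lemma Ck_is_diff (V W : normedModType R) k (A : set V) (f : V -> W) u :
  Ck k.+1 A f -> A u -> is_diff u f ('d f u).
Proof. by move=> [df _] /df ?; exact: is_diffI. Qed.

Lemma Ck_cst (V W : normedModType R) k (A : set V) (w : W) :
  Ck k A (fun _ : V => w).
Proof.
elim: k w => [|k IH] w /=; first by move=> u _; exact: cst_continuous.
split=> [u _|v]; first exact: differentiable_cst.
have -> : 'D_v (fun _ : V => w) = fun _ => 0.
  by apply/funext => u; exact: (derive_cst w).
exact: IH.
Qed.

Lemma Ck_linear d (W : normedModType R) k (A : set 'rV[R]_d)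
  (f : {linear 'rV[R]_d -> W}) : Ck k A f.
Proof.
case: k => [|k] /=; first by move=> u _; exact: linear_rV_continuous.
split=> [u _|v]; first exact: is_diff_differentiable (is_diff_linear _ _).
have -> : 'D_v f = fun _ => f v.
  by apply/funext => u; exact: is_diff_derive (is_diff_linear _ _).
exact: Ck_cst.
Qed.

Lemma Ck_add (V W : normedModType R) k (A : set V) (f g : V -> W) : open A ->
  Ck k A f -> Ck k A g -> Ck k A (fun u => f u + g u).
Proof.
move=> oA; elim: k f g => [|k IH] f g /=.
  by move=> cf cg u Au; apply: continuousD; [exact: cf|exact: cg].
move=> [df cf] [dg cg]; split=> [u Au|v].
  by apply: differentiableD; [exact: df|exact: dg].
apply: (Ck_ext oA) (IH _ _ (cf v) (cg v)) => u Au.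
by rewrite deriveD //; apply: diff_derivable; [exact: df|exact: dg].
Qed.

Lemma Ck_scale (V W : normedModType R) k (A : set V) (f : V -> R^o) (g : V -> W) :
  open A -> Ck k A f -> Ck k A g -> Ck k A (fun u => f u *: g u).
Proof.
move=> oA; elim: k f g => [|k IH] f g.
  move=> /= cf cg u Au; exact: (continuousZ (cf u Au) (cg u Au)).
move=> fA gA; split=> [u Au|v].
  exact: is_diff_differentiable
    (is_diff_scale (Ck_is_diff fA Au) (Ck_is_diff gA Au)).
apply: (Ck_ext oA (f := fun u => f u *: 'D_v g u + 'D_v f u *: g u)).
  move=> u Au; have fu := Ck_is_diff fA Au; have gu := Ck_is_diff gA Au.
  by rewrite (is_diff_derive _ (is_diff_scale fu gu)) !(is_diff_derive _ fu)
    (is_diff_derive _ gu).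
have [_ fA'] := fA; have [_ gA'] := gA.
exact: (Ck_add oA (IH _ _ (CkW fA) (gA' v)) (IH _ _ (fA' v) (CkW gA))).
Qed.

Lemma Ck_sum (V W : normedModType R) k (A : set V) (I : finType)
    (f : I -> V -> W) : open A ->
  (forall i, Ck k A (f i)) -> Ck k A (fun u => \sum_i f i u).
Proof.
move=> oA fA.
rewrite (_ : (fun u => _) = \sum_i f i); last by apply/funext => u; rewrite fct_sumE.
elim/big_ind : _ => [|g h gA hA|//]; first exact: Ck_cst.
exact: (Ck_add oA gA hA).
Qed.

Lemma Ck_coord d (V : normedModType R) k (A : set V) (f : V -> 'rV[R]_d) i :
  open A -> Ck k A f -> Ck k A (fun u => f u ord0 i : R^o).
Proof.
move=> oA; elim: k f => [|k IH] f.
  move=> /= cf u Au; apply: (@continuous_comp _ _ _ f (fun w : 'rV[R]_d => w ord0 i)).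
    exact: cf.
  exact: coord_continuous.
move=> fA; split=> [u Au|v].
  exact: is_diff_differentiable (is_diff_coord _ (Ck_is_diff fA Au)).
have [_ /(_ v)/IH] := fA; apply: Ck_ext => // u Au.
have fu := Ck_is_diff fA Au.
by rewrite (is_diff_derive _ fu) (is_diff_derive _ (is_diff_coord _ fu)).
Qed.

(** [Ck] speaks of derivatives in fixed directions, while the chain rule differentiates g in the
    moving direction ['D_v f u]. Expanding that direction in the standard basis leaves products to
    which the induction hypothesis applies. *)
Lemma Ck_comp d (V W : normedModType R) k (A : set V) (B : set 'rV[R]_d)
    (f : V -> 'rV[R]_d) (g : 'rV[R]_d -> W) : open A ->
  (forall u, A u -> B (f u)) -> Ck k A f -> Ck k B g -> Ck k A (g \o f).
Proof.
move=> oA AB; elim: k f g AB => [|k IH] f g AB.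
  by move=> /= cf cg u Au; apply: continuous_comp; [exact: cf|exact/cg/AB].
move=> fA gB; split=> [u Au|v].
  have fu := Ck_is_diff fA Au; have gu := Ck_is_diff gB (AB _ Au).
  exact: is_diff_differentiable (is_diff_comp fu gu).
have [_ fA'] := fA; have [_ gB'] := gB.
apply: (Ck_ext oA (f := fun u => \sum_i ('D_v f u) ord0 i *:
    ('D_(delta_mx ord0 i) g \o f) u)).
  move=> u Au; have fu := Ck_is_diff fA Au; have gu := Ck_is_diff gB (AB _ Au).
  rewrite (is_diff_derive _ (is_diff_comp fu gu)) /= linear_rVE.
  by apply: eq_bigr => i _; rewrite (is_diff_derive _ fu) (is_diff_derive _ gu).
apply: Ck_sum => // i; apply: Ck_scale => //; first exact/Ck_coord/fA'.
exact: (IH _ _ AB (CkW fA) (gB' _)).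
Qed.

Lemma Ck_rV d (V : normedModType R) k (A : set V) (f : V -> 'rV[R]_d) :
  open A -> (forall i, Ck k A (fun u => f u ord0 i : R^o)) -> Ck k A f.
Proof.
move=> oA fA.
rewrite (_ : f = fun y => \sum_i f y ord0 i *: delta_mx ord0 i); last first.
  by apply/funext => y; rewrite -row_sum_delta.
by apply: Ck_sum => // i; apply: Ck_scale => //; exact: Ck_cst.
Qed.

Lemma is_diff_eps (V W : normedModType R) (f df : V -> W) (x : V) :
  is_diff x f df -> forall e, 0 < e ->
  \forall h \near (0 : V), `|f (h + x) - f x - df h| <= e * `|h|.
Proof.
move=> [dfx dfE] e e0; have ef := diff_locally dfx.
have := (eqaddoP _ _ _ _).1 ef _ e0; apply: filterS => h /=.
by rewrite !fctE /= dfE opprD addrA.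
Qed.

(* Only the differentiability of 'D_w g at u is used (not the continuity of the
   second derivatives): the mean value theorem turns the second difference into
   an increment of 'D_w g. *)
Lemma second_difference (V : normedModType R) (g : V -> R^o) (u v w : V)
    (L : V -> R^o) :
  (\forall z \near u, differentiable g z) -> is_diff u ('D_w g) L ->
  (forall a b, L (a + b) = L a + L b) -> (forall (s : R) b, L (s *: b) = s *: L b) ->
  forall e, 0 < e -> \forall s \near 0^'+,
  `|g (s *: v + s *: w + u) - g (s *: v + u) - g (s *: w + u) + g u
    - s ^+ 2 * L v| <= e * s ^+ 2.
Proof.
move=> gd gL LD LZ e e0.
pose n := `|v| + `|w|.
have n0 : 0 <= n by rewrite addr_ge0.
(* The two increments of ['D_w g] below have errors at most [e / C * (s * n)] each, so C must
   dominate [n + n]; the added 1 keeps C positive when v = w = 0. *)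
pose C : R := n + n + 1.
have C0 : 0 < C by rewrite ltr_wpDl// !addr_ge0.
have /nbhs_norm0P[d1 /= d10 gd1] : \forall h \near (0 : V), differentiable g (h + u).
  by move: gd; rewrite (near_shift 0) subr0.
have /nbhs_norm0P[d2 /= d20 gL1] := is_diff_eps gL (divr_gt0 e0 C0).
pose d := Num.min d1 d2.
have d0 : 0 < d by rewrite lt_min d10.
near=> s.
have s0 : 0 < s by near: s; exact: nbhs_right_gt.
have sC : s * C < d.
  by rewrite -ltr_pdivlMr//; near: s; apply: nbhs_right_lt; rewrite divr_gt0.
have hd a t : 0 <= a <= s -> 0 <= t <= s ->
    `|a *: v + t *: w| <= s * n.
  move=> /andP[a0 as_] /andP[t0 ts].
  rewrite (le_trans (ler_normD _ _))// !normrZ (ger0_norm a0) (ger0_norm t0).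
  by rewrite /n mulrDr lerD// ler_wpM2r.
have hd' a t : 0 <= a <= s -> 0 <= t <= s -> `|a *: v + t *: w| < d.
  move=> ha ht; apply: le_lt_trans sC; apply: (le_trans (hd _ _ ha ht)).
  by rewrite ler_pM2l// /C -addrA lerDl addr_ge0.
have gdiff a t : 0 <= a <= s -> 0 <= t <= s ->
    differentiable g (a *: v + t *: w + u).
  by move=> ha ht; apply: gd1; have := hd' _ _ ha ht; rewrite lt_min => /andP[].
have s01 : 0 <= s <= s by rewrite lexx ltW.
have s00 : 0 <= (0 : R) <= s by rewrite lexx ltW.
pose phi (t : R) : R := g (s *: v + t *: w + u) - g (0 *: v + t *: w + u).
pose dphi (t : R) : R := 'D_w g (s *: v + t *: w + u) - 'D_w g (0 *: v + t *: w + u).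
have line a (t : R) : 0 <= a <= s -> 0 <= t <= s ->
    is_derive t 1 (fun t => g (a *: v + t *: w + u) : R)
      ('D_w g (a *: v + t *: w + u)).
  move=> ha ht; have gt := gdiff _ _ ha ht.
  have aff : is_diff t (fun t : R => a *: v + t *: w + u) (fun h => 0 + h *: w + 0).
    exact: is_diffD.
  have := is_diff_comp aff (is_diffI gt) => gc.
  apply: DeriveDef; first exact: diff_derivable (is_diff_differentiable gc).
  by rewrite (is_diff_derive _ gc) /= deriveE// scale1r add0r addr0.
have phi' (t : R) : 0 <= t <= s -> is_derive t 1 phi (dphi t).
  by move=> ht; exact: is_deriveB (line _ _ s01 ht) (line _ _ s00 ht).
have [] := @MVT _ phi dphi 0 s s0.
- by move=> t; rewrite in_itv/= => /andP[t0 ts]; apply: phi'; rewrite !ltW.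
- apply: derivable_within_continuous => t; rewrite in_itv/= => ht.
  by have [] := phi' _ ht.
move=> t; rewrite in_itv/= subr0 => /andP[t0 ts] phiE.
have ht : 0 <= t <= s by rewrite !ltW.
have -> : g (s *: v + s *: w + u) - g (s *: v + u) - g (s *: w + u) + g u
    = s * dphi t.
  rewrite mulrC -phiE /phi !scale0r !addr0 !add0r.
  move: (g _) (g _) (g _) (g _) => g1 g2 g3 g4; rewrite /GRing.scale/=; ring.
have dL a : 0 <= a <= s ->
    `|'D_w g (a *: v + t *: w + u) - 'D_w g u - L (a *: v + t *: w)|
    <= e / C * (s * n).
  move=> ha; apply: (le_trans (gL1 _ _)).
    by have := hd' _ _ ha ht; rewrite lt_min => /andP[].
  by apply: ler_wpM2l (hd _ _ ha ht); rewrite divr_ge0 ?ltW.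
(* By linearity L(sv + tw) - L(0v + tw) = s L(v): the unknown intermediate point t disappears from
   the main term. *)
have -> : s * dphi t - s ^+ 2 * L v =
   s * (('D_w g (s *: v + t *: w + u) - 'D_w g u - L (s *: v + t *: w)) -
   ('D_w g (0 *: v + t *: w + u) - 'D_w g u - L (0 *: v + t *: w))).
  rewrite /dphi !LD !LZ scale0r /GRing.scale/=; ring.
rewrite normrM (gtr0_norm s0) expr2 mulrCA ler_pM2l//.
apply: le_trans (ler_normB _ _) _; apply: le_trans (lerD (dL _ s01) (dL _ s00)) _.
rewrite -mulrDr -mulrDr mulrCA mulrC ler_pM2r// -mulrA.
apply: ler_piMr; first exact: ltW.
by rewrite mulrC ler_pdivrMr// mul1r /C lerDl.
Unshelve. all: by end_near. Qed.

(** The second difference is symmetric in v and w, so s^2 times either side approximates it within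
    e/2 s^2; dividing by s^2 bounds their distance by e. *)
Lemma derive_sym (V : normedModType R) (g : V -> R^o) (u v w : V) :
  (\forall z \near u, differentiable g z) -> differentiable ('D_v g) u ->
  differentiable ('D_w g) u -> 'd ('D_v g) u w = 'd ('D_w g) u v.
Proof.
move=> gd gv gw; apply/eqP; rewrite -subr_eq0 -normr_le0.
apply/ler_addgt0Pr => e e0; rewrite add0r.
have e20 : 0 < e / 2 by rewrite divr_gt0.
have [s s0 [h1 h2]] : exists2 s : R, 0 < s &
    (`|g (s *: v + s *: w + u) - g (s *: v + u) - g (s *: w + u) + g u
      - s ^+ 2 * 'd ('D_w g) u v| <= (e / 2) * s ^+ 2) /\
    (`|g (s *: w + s *: v + u) - g (s *: w + u) - g (s *: v + u) + g u
      - s ^+ 2 * 'd ('D_v g) u w| <= (e / 2) * s ^+ 2).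
  near (0 : R)^'+ => s; exists s; first by near: s; exact: nbhs_right_gt.
  split; near: s; apply: second_difference => //; try exact: is_diffI;
    by move=> *; rewrite ?linearD ?linearZ.
have s20 : 0 < s ^+ 2 by rewrite exprn_gt0.
rewrite -(ler_pM2r s20) -{1}(gtr0_norm s20) -normrM.
have -> : e * s ^+ 2 = e / 2 * s ^+ 2 + e / 2 * s ^+ 2 by rewrite -mulrDl -splitr.
apply: le_trans (lerD h1 h2).
apply: le_trans (ler_normB _ _); rewrite le_eqVlt; apply/orP; left.
apply/eqP; congr (`|_|); rewrite [s *: w + s *: v]addrC.
have alg (a b c a' x y q : R) :
  (y - x) * q = (a - b - c + a' - q * x) - (a - c - b + a' - q * y) by ring.
exact: alg.
Unshelve. all: by end_near. Qed.

Lemma Ck_derive_sym d e (A : set 'rV[R]_d) (f : 'rV[R]_d -> 'rV[R]_e) u v w :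
  open A -> Ck 2 A f -> A u -> 'd ('D_v f) u w = 'd ('D_w f) u v.
Proof.
move=> oA fA Au; apply/rowP => i.
have ci : Ck 2 A (fun u => f u ord0 i : R^o) by exact: Ck_coord.
have nA : \forall z \near u, A z by exact: open_nbhs_nbhs.
have Dc v' : is_diff u ('D_v' (fun u => f u ord0 i : R^o))
    (fun h => 'd ('D_v' f) u h ord0 i).
  have := is_diff_coord i (Ck_is_diff (CkD v' fA) Au); apply: is_diff_near.
  apply: filterS nA => z Az; have fz := Ck_is_diff fA Az.
  by rewrite (is_diff_derive v' (is_diff_coord i fz)) (is_diff_derive v' fz).
pose g := fun u => f u ord0 i : R^o.
have Ev : 'd ('D_v g) u w = 'd ('D_v f) u w ord0 i.
  exact: is_diffE (Dc v) w.
have Ew : 'd ('D_w g) u v = 'd ('D_w f) u v ord0 i.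
  exact: is_diffE (Dc w) v.
rewrite -Ev -Ew; apply: derive_sym.
- by apply: filterS nA => z Az; exact: (is_diff_differentiable (Ck_is_diff ci Az)).
- exact: is_diff_differentiable (Dc v).
- exact: is_diff_differentiable (Dc w).
Qed.

Lemma is_diff_diff d (U W : normedModType R) (A : set 'rV[R]_d)
    (F : 'rV[R]_d -> W) (p v dp dv : U -> 'rV[R]_d) t :
  open A -> Ck 2 A F -> A (p t) -> is_diff t p dp -> is_diff t v dv ->
  is_diff t (fun s => 'd F (p s) (v s))
    (fun h => 'd ('D_(v t) F) (p t) (dp h) + 'd F (p t) (dv h)).
Proof.
move=> oA FA Apt pt vt.
have nA : \forall z \near p t, A z by exact: open_nbhs_nbhs.
pose D i := 'D_(delta_mx ord0 i) F.
have DE v' z : A z -> 'D_v' F z = \sum_i v' ord0 i *: D i z.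
  move=> Az; have Fz := Ck_is_diff FA Az.
  rewrite (is_diff_derive _ Fz) linear_rVE.
  by apply: eq_bigr => i _; rewrite /D (is_diff_derive _ Fz).
have Dd i : is_diff (p t) (D i) ('d (D i) (p t)) by exact: Ck_is_diff (CkD _ FA) Apt.
have DvE v' h : 'd ('D_v' F) (p t) h = \sum_i v' ord0 i *: 'd (D i) (p t) h.
  have dc i := is_diff_scale (is_diff_cst (v' ord0 i : R^o) (p t)) (Dd i).
  have nE : \forall z \near p t, \sum_i v' ord0 i *: D i z = 'D_v' F z.
    by apply: filterS nA => z Az; rewrite DE.
  apply: etrans (is_diffE (is_diff_near nE (is_diff_sum dc)) h) _.
  by apply: eq_bigr => i _ /=; rewrite scale0r addr0.
have cp : {for t, continuous p}.
  apply: differentiable_continuous.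
  exact: is_diff_differentiable pt.
have dFE z v' : A z -> 'd F z v' = \sum_i v' ord0 i *: D i z.
  by move=> Az; rewrite -DE// (is_diff_derive _ (Ck_is_diff FA Az)).
have nE : \forall s \near t, \sum_i v s ord0 i *: (D i \o p) s = 'd F (p s) (v s).
  have nAp : \forall s \near t, A (p s) by exact: cp _ nA.
  by apply: filterS nAp => s As; rewrite dFE.
have S := is_diff_sum (fun i => is_diff_scale (is_diff_coord i vt)
  (is_diff_comp pt (Dd i))).
apply: is_diff_eq (is_diff_near nE S) _.
apply/funext => h; apply: etrans (big_split _ _ _ _ _) _.
by congr (_ + _); [exact: esym (DvE (v t) (dp h))|exact: esym (dFE _ _ Apt)].
Qed.

End CkCalculus.

(** * Manifolds in charts, related vector fields *)

Section Charts.
Context {R : realType} {d : nat} {M : manifold R d}.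
Implicit Types (p z : M) (u : 'rV[R]_d).

Lemma cdom_cinv p u : (chart p @` cdom p) u -> cdom p (cinv p u).
Proof. by move=> [z pz <-]; rewrite chartK. Qed.

Lemma cinvK p u : (chart p @` cdom p) u -> chart p (cinv p u) = u.
Proof. by move=> [z pz <-]; rewrite chartK. Qed.

Lemma cinv_near p z (P : set M) : cdom p z -> (\near z, P z) ->
  \forall u \near chart p z, P (cinv p u).
Proof.
move=> pz zP; have : {for chart p z, continuous (cinv p)}.
  by apply: cinv_continuous; exists z.
by rewrite /prop_for /continuous_at chartK//; apply.
Qed.

Lemma cdom_near p z : cdom p z -> \near z, cdom p z.
Proof. by move=> pz; apply: open_nbhs_nbhs; split => //; exact: cdom_open. Qed.

Lemma open_chart p (O : set M) : open O -> open (chart p @` (cdom p `&` O)).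
Proof.
move=> oO; rewrite openE => _ [z [pz Oz] <-]; rewrite /interior.
have Oz' : \near z, O z by exact: open_nbhs_nbhs.
have I : nbhs (chart p z) (chart p @` cdom p).
  by apply: open_nbhs_nbhs; split; [exact: chart_image_open|exists z].
have J := cinv_near pz Oz'.
apply: filterS2 I J => u Iu Ou; exists (cinv p u); last exact: cinvK.
by split=> //; exact: cdom_cinv.
Qed.

End Charts.

Section LocalMaps.
Context {R : realType}.

(** Makes chart transitions the local expressions of the identity map, so that changes of chart and
    differentials of maps obey a single chain rule, [dloc_comp]. *)
Lemma smooth_id d (M : manifold R d) : smooth_map (@id M).
Proof. by split=> [z //|p q]; exact: chart_transition. Qed.

(* The differential of f at z read in the chart of index p at z and the chart of
   index q at f z; so tmap f z is dloc f z (f z) z, and dloc id z p z converts a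
   tangent vector at z to its components in the chart of index p. *)
Definition dloc d1 d2 (M : manifold R d1) (N : manifold R d2) (f : M -> N)
    (p : M) (q : N) (z : M) : {linear 'rV[R]_d1 -> 'rV[R]_d2} :=
  'd (chart q \o f \o cinv p) (chart p z).

Lemma smooth_Ck d1 d2 (M : manifold R d1) (N : manifold R d2) (f : M -> N) p q k :
  smooth_map f -> Ck k (chart p @` (cdom p `&` f @^-1` cdom q)) (chart q \o f \o cinv p).
Proof. by move=> [_ fs]; exact: fs. Qed.

Lemma smooth_open d1 d2 (M : manifold R d1) (N : manifold R d2) (f : M -> N) p q :
  smooth_map f -> open (chart p @` (cdom p `&` f @^-1` cdom q)).
Proof.
move=> [fc _]; apply: open_chart; apply: open_comp => [z _|]; first exact: fc.
exact: cdom_open.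
Qed.

Lemma is_diff_loc d1 d2 (M : manifold R d1) (N : manifold R d2) (f : M -> N) p q z :
  smooth_map f -> cdom p z -> cdom q (f z) ->
  is_diff (chart p z) (chart q \o f \o cinv p) (dloc f p q z).
Proof. by move=> fs pz qz; apply: (Ck_is_diff (smooth_Ck p q 1 fs)); exists z. Qed.

Lemma dloc_comp d1 d2 d3 (M : manifold R d1) (N : manifold R d2)
    (P : manifold R d3) (f : M -> N) (g : N -> P) p q r z v :
  smooth_map f -> smooth_map g -> cdom p z -> cdom q (f z) -> cdom r (g (f z)) ->
  dloc (g \o f) p r z v = dloc g q r (f z) (dloc f p q z v).
Proof.
move=> fs gs pz qz rz.
have df := is_diff_loc fs pz qz; have dg := is_diff_loc gs qz rz.
have fz : (chart q \o f \o cinv p) (chart p z) = chart q (f z) by rewrite /= chartK.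
rewrite -fz in dg; have dgf := is_diff_comp df dg.
suff H : is_diff (chart p z) (chart r \o (g \o f) \o cinv p)
   (dloc g q r (f z) \o dloc f p q z) by exact: is_diffE H v.
apply: is_diff_near dgf; apply: (cinv_near (P := fun y =>
  chart r (g (cinv q (chart q (f y)))) = chart r (g (f y))) pz).
have nq : \forall y \near z, cdom q (f y) by exact: fs.1 z _ (cdom_near qz).
by apply: filterS nq => y qy; rewrite chartK.
Qed.

Lemma dloc_id d (M : manifold R d) p z v : cdom p z -> dloc (@id M) p p z v = v.
Proof.
move=> pz; have nE : \forall u \near chart p z, id u = (chart p \o id \o cinv p) u.
  apply: filterS (_ : \forall u \near chart p z, (chart p @` cdom p) u).
    by move=> u pu; rewrite /= cinvK.
  by apply: open_nbhs_nbhs; split; [exact: chart_image_open|exists z].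
exact: is_diffE (is_diff_near nE (is_diff_id _)) v.
Qed.

(** The chain rule for f composed with the identity on either side, the two identities standing for
    the passage from the centered charts to p and q. *)
Lemma tmap_loc d1 d2 (M : manifold R d1) (N : manifold R d2) (f : M -> N) p q z v :
  smooth_map f -> cdom p z -> cdom q (f z) ->
  dloc f p q z (dloc id z p z v) = dloc id (f z) q (f z) (tmap f z v).
Proof.
move=> fs pz qz.
have h1 := @dloc_comp _ _ _ M M N id f z p q z v
  (smooth_id M) fs (cdom_center z) pz qz.
have h2 := @dloc_comp _ _ _ M N N f id z (f z) q z v
  fs (smooth_id N) (cdom_center z) (cdom_center (f z)) qz.
exact: etrans (esym h1) h2.
Qed.

Lemma tmap_loc_center d1 d2 (M : manifold R d1) (N : manifold R d2) (f : M -> N) q z v :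
  smooth_map f -> cdom q (f z) ->
  dloc f z q z v = dloc id (f z) q (f z) (tmap f z v).
Proof.
move=> fs qz; apply: etrans _ (tmap_loc v fs (cdom_center z) qz).
by apply: congr1; exact: esym (dloc_id v (cdom_center z)).
Qed.

Lemma tmap_comp d1 d2 d3 (M : manifold R d1) (N : manifold R d2)
    (P : manifold R d3) (f : M -> N) (g : N -> P) z v :
  smooth_map f -> smooth_map g -> tmap (g \o f) z v = tmap g (f z) (tmap f z v).
Proof.
move=> fs gs; apply: (dloc_comp (p := z) (q := f z) (r := g (f z))) => //;
exact: cdom_center.
Qed.

Lemma vfield_inE d (M : manifold R d) p X z : cdom p z ->
  @vfield_in R d M p X (chart p z) = dloc id z p z (X z).
Proof. by move=> pz; rewrite /vfield_in/= chartK. Qed.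

Lemma vfield_in_center d (M : manifold R d) (X : M -> 'rV[R]_d) z :
  vfield_in z X (chart z z) = X z.
Proof. by rewrite vfield_inE ?dloc_id//; exact: cdom_center. Qed.

Section Related.
Context {d1 d2 : nat} {M : manifold R d1} {N : manifold R d2} (f : M -> N).
Hypothesis fs : smooth_map f.

Definition related (X : M -> 'rV[R]_d1) (X' : N -> 'rV[R]_d2) :=
  forall z, tmap f z (X z) = X' (f z).

Lemma related_loc X X' p q z : related X X' -> cdom p z -> cdom q (f z) ->
  vfield_in q X' (chart q (f z)) = dloc f p q z (vfield_in p X (chart p z)).
Proof. by move=> XX' pz qz; rewrite !vfield_inE// tmap_loc// XX'. Qed.

(* In charts, differentiate X' o F = dF X; the second derivatives of F cancel by
   symmetry. *)
Lemma related_bracket X X' Y Y' a : related X X' -> related Y Y' ->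
  differentiable (vfield_in a X) (chart a a) ->
  differentiable (vfield_in a Y) (chart a a) ->
  differentiable (vfield_in (f a) X') (chart (f a) (f a)) ->
  differentiable (vfield_in (f a) Y') (chart (f a) (f a)) ->
  tmap f a (vbracket X Y a) = vbracket X' Y' (f a).
Proof.
move=> XX' YY' dX dY dX' dY'.
pose F := chart (f a) \o f \o cinv a.
pose A := chart a @` (cdom a `&` f @^-1` cdom (f a)).
have oA : open A by exact: smooth_open.
have FA : Ck 2 A F by exact: smooth_Ck.
have Aa : A (chart a a) by exists a => //; split; exact: cdom_center.
have Fa : F (chart a a) = chart (f a) (f a).
  by rewrite /F/= chartK//; exact: cdom_center.
have nA : \forall u \near chart a a, A u by exact: open_nbhs_nbhs.
have key Z Z' : related Z Z' -> differentiable (vfield_in a Z) (chart a a) ->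
  differentiable (vfield_in (f a) Z') (chart (f a) (f a)) -> forall h,
  'd (vfield_in (f a) Z') (chart (f a) (f a)) (tmap f a h) =
  'd ('D_(Z a) F) (chart a a) h + tmap f a ('d (vfield_in a Z) (chart a a) h).
  move=> ZZ' dZ dZ' h.
  have := is_diff_diff oA FA Aa (is_diff_id (chart a a)) (is_diffI dZ).
  rewrite vfield_in_center => /is_diffE/(_ h) <-.
  apply/esym; have dZF : is_diff (chart a a) (vfield_in (f a) Z' \o F)
      ('d (vfield_in (f a) Z') (chart (f a) (f a)) \o tmap f a).
    apply: is_diff_comp; first by apply: is_diff_loc => //; exact: cdom_center.
    by rewrite Fa; exact: is_diffI.
  have nE : \forall u \near chart a a,
      (vfield_in (f a) Z' \o F) u = 'd F u (vfield_in a Z u).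
    apply: filterS nA => _ [z [pz qz] <-].
    by rewrite /F /= chartK// (related_loc ZZ' pz qz).
  exact: is_diffE (is_diff_near nE dZF) h.
have kX := key _ _ YY' dY dY' (X a).
have kY := key _ _ XX' dX dX' (Y a).
have -> : vbracket X' Y' (f a) =
    'd (vfield_in (f a) Y') (chart (f a) (f a)) (tmap f a (X a))
    - 'd (vfield_in (f a) X') (chart (f a) (f a)) (tmap f a (Y a)).
  by rewrite (XX' a) (YY' a).
have alg (p q x y : 'rV[R]_d2) : p = q -> x - y = (p + x) - (q + y).
  by move=> ->; rewrite opprD addrACA subrr add0r.
apply: etrans _ (esym (congr2 (fun x y => x - y) kX kY)).
apply: etrans (linearB _ _ _) _; apply: alg.
exact: Ck_derive_sym oA FA Aa.
Qed.

End Related.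

End LocalMaps.

(** * Maps of two variables *)

Section RowDiff.
Context {R : realType}.

Lemma is_diff_row (V : normedModType R) d1 d2 (p dp : V -> 'rV[R]_d1)
    (q dq : V -> 'rV[R]_d2) x : is_diff x p dp -> is_diff x q dq ->
  is_diff x (fun y => row_mx (p y) (q y)) (fun h => row_mx (dp h) (dq h)).
Proof.
move=> px qx.
have rowE (u : 'rV[R]_d1) (v : 'rV[R]_d2) :
    row_mx u v = mulmxr (row_mx 1%:M 0) u + mulmxr (row_mx 0 1%:M) v.
  by rewrite /= !mul_mx_row !mulmx0 !mulmx1 add_row_mx addr0 add0r.
rewrite (_ : (fun y => _) = (mulmxr (row_mx 1%:M 0) \o p) +
    (mulmxr (row_mx 0 1%:M) \o q)); last by apply/funext => y; rewrite rowE.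
rewrite (_ : (fun h => _) = (mulmxr (row_mx 1%:M 0) \o dp) +
    (mulmxr (row_mx 0 1%:M) \o dq)); last by apply/funext => y; rewrite rowE.
by apply: is_diffD; apply: is_diff_comp; exact: is_diff_linear.
Qed.

Lemma Ck_row (V : normedModType R) d1 d2 k (A : set V) (p : V -> 'rV[R]_d1)
    (q : V -> 'rV[R]_d2) : open A -> Ck k A p -> Ck k A q ->
  Ck k A (fun y => row_mx (p y) (q y)).
Proof.
move=> oA pA qA; apply: Ck_rV => // i.
rewrite -(splitK i); case: (fintype.split i) => j /=.
  by under eq_fun do rewrite row_mxEl; exact: Ck_coord.
by under eq_fun do rewrite row_mxEr; exact: Ck_coord.
Qed.

Lemma Ck_id d k (A : set 'rV[R]_d) : Ck k A id.
Proof. exact: (Ck_linear k A idfun). Qed.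

Lemma is_diff_bilinear d1 d2 (U W : normedModType R) (b : 'rV[R]_d1 -> 'rV[R]_d2 -> W)
    (p dp : U -> 'rV[R]_d1) (q dq : U -> 'rV[R]_d2) x :
  (forall v, linear (b^~ v)) -> (forall u, linear (b u)) ->
  is_diff x p dp -> is_diff x q dq ->
  is_diff x (fun y => b (p y) (q y)) (fun h => b (p x) (dq h) + b (dp h) (q x)).
Proof.
move=> bl br px qx.
have bE u v : b u v = \sum_i u ord0 i *: \sum_j v ord0 j *:
    b (delta_mx ord0 i) (delta_mx ord0 j).
  pose blM := GRing.isLinear.Build _ _ _ _ _ (bl v).
  pose bL : {linear 'rV[R]_d1 -> W} := HB.pack (b^~ v) blM.
  apply: etrans (linear_rVE bL u) _; apply: eq_bigr => i _; congr (_ *: _).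
  pose brM := GRing.isLinear.Build _ _ _ _ _ (br (delta_mx ord0 i)).
  pose bR : {linear 'rV[R]_d2 -> W} := HB.pack (b (delta_mx ord0 i)) brM.
  exact: linear_rVE bR v.
have c i j : is_diff x (fun _ : U => b (delta_mx ord0 i) (delta_mx ord0 j)) (0 : U -> W).
  exact: is_diff_cst.
have S := is_diff_sum (fun i => is_diff_scale (is_diff_coord i px)
  (is_diff_sum (fun j => is_diff_scale (is_diff_coord j qx) (c i j)))).
rewrite (_ : (fun y => _) = fun y => \sum_i p y ord0 i *: \sum_j q y ord0 j *:
    b (delta_mx ord0 i) (delta_mx ord0 j)); last by apply/funext => y; rewrite bE.
apply: is_diff_eq S _; apply/funext => h; rewrite !bE -big_split.
apply: eq_bigr => i _; congr (_ *: _ + _).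
by apply: eq_bigr => j _; rewrite scaler0 add0r.
Qed.

End RowDiff.

Section SmoothComp.
Context {R : realType}.

(** No single chart of N need contain the values of f on the whole domain of the local expression.
    Since C^k is a local property, a neighbourhood of each point is used on which f stays in the
    chart centered at [f z]. *)
Lemma smooth_comp d1 d2 d3 (M : manifold R d1) (N : manifold R d2)
    (P : manifold R d3) (f : M -> N) (g : N -> P) :
  smooth_map f -> smooth_map g -> smooth_map (g \o f).
Proof.
move=> fs gs; split=> [z|p q k]; first by apply: continuous_comp; [exact: fs.1|exact: gs.1].
apply: Ck_local => _ [z [pz qz] <-].
have oq : open (cdom (f z) `&` g @^-1` cdom q).
  apply: openI; first exact: cdom_open.
  by apply: open_comp => [y _|]; [exact: gs.1|exact: cdom_open].
pose B := chart p @` (cdom p `&` f @^-1` (cdom (f z) `&` g @^-1` cdom q)).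
have oB : open B.
  by apply: open_chart; apply: open_comp => [y _|//]; exact: fs.1.
exists B; first by exists z => //; split => //; split => //; exact: cdom_center.
have fB : Ck k B (chart (f z) \o f \o cinv p).
  by apply: Ck_sub (smooth_Ck p (f z) k fs) => _ [y [py [fy _]] <-]; exists y.
apply: Ck_ext oB _ (Ck_comp oB _ fB (smooth_Ck (f z) q k gs)).
  by move=> _ [y [py [fy _]] <-]; rewrite /= !chartK.
by move=> _ [y [py [fy gy]] <-]; exists (f y); rewrite //= chartK.
Qed.

Section Map2.
Context {d1 d2 d3 : nat} {M1 : manifold R d1} {M2 : manifold R d2}
  {N : manifold R d3}.
Variable f : M1 -> M2 -> N.
Hypothesis fs : smooth_map2 f.

Definition loc2 p q o (w : 'rV[R]_(d1 + d2)) :=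
  chart o (f (cinv p (lsubmx w)) (cinv q (rsubmx w))).

Definition dom2 p q o := [set w : 'rV[R]_(d1 + d2) |
  [/\ (chart p @` cdom p) (lsubmx w), (chart q @` cdom q) (rsubmx w) &
      cdom o (f (cinv p (lsubmx w)) (cinv q (rsubmx w)))]].

Lemma loc2_Ck p q o k : Ck k (dom2 p q o) (loc2 p q o).
Proof. exact: fs.2. Qed.

Lemma dom2P p q o a b : cdom p a -> cdom q b -> cdom o (f a b) ->
  dom2 p q o (row_mx (chart p a) (chart q b)).
Proof.
move=> pa qb ob; rewrite /dom2/= row_mxKl row_mxKr !chartK//.
by split=> //; [exists a|exists b].
Qed.

Lemma loc2E p q o a b : cdom p a -> cdom q b ->
  loc2 p q o (row_mx (chart p a) (chart q b)) = chart o (f a b).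
Proof. by move=> pa qb; rewrite /loc2/= row_mxKl row_mxKr !chartK. Qed.

Lemma dom2_open p q o : open (dom2 p q o).
Proof.
rewrite openE => w [lw rw ow]; rewrite /interior.
have lc : {for w, continuous (lsubmx : 'rV[R]_(d1 + d2) -> 'rV[R]_d1)}.
  exact: continuous_lsubmx.
have rc : {for w, continuous (rsubmx : 'rV[R]_(d1 + d2) -> 'rV[R]_d2)}.
  exact: continuous_rsubmx.
have nl : \forall w' \near w, (chart p @` cdom p) (lsubmx w').
  apply: (lc); apply: open_nbhs_nbhs; split => //; exact: chart_image_open.
have nr : \forall w' \near w, (chart q @` cdom q) (rsubmx w').
  apply: (rc); apply: open_nbhs_nbhs; split => //; exact: chart_image_open.
have cl : {for w, continuous (fun w => cinv p (lsubmx w))}.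
  by apply: continuous_comp => //; exact: cinv_continuous.
have cr : {for w, continuous (fun w => cinv q (rsubmx w))}.
  by apply: continuous_comp => //; exact: cinv_continuous.
have no : \forall w' \near w, cdom o (f (cinv p (lsubmx w')) (cinv q (rsubmx w'))).
  have no' := cdom_near ow.
  have nf : \forall y \near (cinv p (lsubmx w), cinv q (rsubmx w)), cdom o (f y.1 y.2).
    exact: (fs.1 (cinv p (lsubmx w), cinv q (rsubmx w))) no'.
  exact: (cvg_pair cl cr) nf.
by near=> w'; split; near: w'.
Unshelve. all: by end_near. Qed.

Lemma smooth_map2l a : smooth_map (f a).
Proof.
have fa : continuous (f a).
  move=> b; apply: (@continuous_comp _ _ _ (fun b => (a, b)) (fun y => f y.1 y.2)).
    by apply: cvg_pair; [exact: cvg_cst|exact: cvg_id].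
  exact: fs.1.
split=> // p q k.
have oA : open (chart p @` (cdom p `&` f a @^-1` cdom q)).
  by apply: open_chart; apply: open_comp => [b _|]; [exact: fa|exact: cdom_open].
have aff : Ck k (chart p @` (cdom p `&` f a @^-1` cdom q))
  (fun u => row_mx (chart a a) u) by apply: Ck_row => //; [exact: Ck_cst|exact: Ck_id].
apply: (Ck_ext oA) (Ck_comp oA _ aff (loc2_Ck a p q k)).
  by move=> _ [b [pb qb] <-]; rewrite /= loc2E ?chartK//; exact: cdom_center.
by move=> _ [b [pb qb] <-]; apply: dom2P => //; exact: cdom_center.
Qed.

Lemma smooth_map2r b : smooth_map (f^~ b).
Proof.
have fb : continuous (f^~ b).
  move=> a; apply: (@continuous_comp _ _ _ (fun a => (a, b)) (fun y => f y.1 y.2)).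
    by apply: cvg_pair; [exact: cvg_id|exact: cvg_cst].
  exact: fs.1.
split=> // p q k.
have oA : open (chart p @` (cdom p `&` (f^~ b) @^-1` cdom q)).
  by apply: open_chart; apply: open_comp => [a _|]; [exact: fb|exact: cdom_open].
have aff : Ck k (chart p @` (cdom p `&` (f^~ b) @^-1` cdom q))
  (fun u => row_mx u (chart b b)) by apply: Ck_row => //; [exact: Ck_id|exact: Ck_cst].
apply: (Ck_ext oA) (Ck_comp oA _ aff (loc2_Ck p b q k)).
  by move=> _ [a [pa qa] <-]; rewrite /= loc2E ?chartK//; exact: cdom_center.
by move=> _ [a [pa qa] <-]; apply: dom2P => //; exact: cdom_center.
Qed.

Lemma loc2_diff p q o a b : cdom p a -> cdom q b -> cdom o (f a b) ->
  is_diff (row_mx (chart p a) (chart q b)) (loc2 p q o)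
    ('d (loc2 p q o) (row_mx (chart p a) (chart q b))).
Proof. by move=> pa qb ob; exact: (Ck_is_diff (loc2_Ck p q o 1) (dom2P pa qb ob)). Qed.

(** Turns the differential of a map that depends on a into a joint differential at a moving point,
    the form that [is_diff_diff] can differentiate with respect to a. *)
Lemma dloc2l p q o a b v : cdom p a -> cdom q b -> cdom o (f a b) ->
  dloc (f a) q o b v =
  'd (loc2 p q o) (row_mx (chart p a) (chart q b)) (row_mx 0 v).
Proof.
move=> pa qb ob.
have df := is_diff_comp (is_diff_row (is_diff_cst (chart p a) (chart q b))
  (is_diff_id (chart q b))) (loc2_diff pa qb ob).
suff E : chart o \o f a \o cinv q = loc2 p q o \o (fun u => row_mx (chart p a) u).
  by rewrite /dloc E; exact: is_diffE df v.
by apply/funext => u; rewrite /loc2/= row_mxKl row_mxKr chartK.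
Qed.

Lemma dloc2r p q o a b v : cdom p a -> cdom q b -> cdom o (f a b) ->
  dloc (f^~ b) p o a v =
  'd (loc2 p q o) (row_mx (chart p a) (chart q b)) (row_mx v 0).
Proof.
move=> pa qb ob.
have df := is_diff_comp (is_diff_row (is_diff_id (chart p a))
  (is_diff_cst (chart q b) (chart p a))) (loc2_diff pa qb ob).
suff E : chart o \o f^~ b \o cinv p = loc2 p q o \o (fun u => row_mx u (chart q b)).
  by rewrite /dloc E; exact: is_diffE df v.
by apply/funext => u; rewrite /loc2/= row_mxKl row_mxKr chartK.
Qed.

End Map2.
End SmoothComp.

Arguments dom2_open {R d1 d2 d3 M1 M2 N f} fs p q o.

(** * Lie groups and their actions *)

Section LieTheory.
Context {R : realType} {r : nat} (G : lieGroup R r).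
Implicit Types (X Y Z : 'rV[R]_r) (a b c : G).

Let one : G := lone G.
Let o := chart one one.

Lemma lmul_smoothl a : smooth_map (lmul a).
Proof. exact: smooth_map2l (@lmul_smooth R r G) a. Qed.

Lemma lmul_smoothr a : smooth_map ((@lmul R r G)^~ a).
Proof. exact: smooth_map2r (@lmul_smooth R r G) a. Qed.

Definition conjl a b : G := lmul (lmul a b) (linv a).

Lemma conjl_smooth a : smooth_map (conjl a).
Proof. exact: smooth_comp (lmul_smoothl a) (lmul_smoothr (linv a)). Qed.

Lemma conjl1 a : conjl a one = one.
Proof. by rewrite /conjl lmulg1 lmulgV. Qed.

Lemma conjlM a b c : conjl a (lmul b c) = lmul (conjl a b) (conjl a c).
Proof. by rewrite /conjl -!lmulA (lmulA (linv a) a) lmulVg lmul1g. Qed.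

Lemma left_invariant1 X : left_invariant X one = X.
Proof.
have E : @lmul R r G one = id by apply/funext => b; rewrite lmul1g.
by rewrite /left_invariant -/one E; exact: (dloc_id _ (cdom_center one)).
Qed.

(** In the fixed chart p the left-invariant field is a partial differential of the multiplication at
    (b, 1); its regularity in b thus comes from the smoothness of the multiplication. *)
Lemma left_invariant_loc p b X : cdom p b ->
  vfield_in p (left_invariant X) (chart p b) =
  'd (loc2 (@lmul R r G) p one p) (row_mx (chart p b) o) (row_mx 0 X).
Proof.
move=> pb; rewrite vfield_inE//.
have pb1 : cdom p (lmul b one) by rewrite lmulg1.
have h1 := tmap_loc_center X (lmul_smoothl b) pb1.
rewrite lmulg1 in h1.
apply: etrans (esym h1) _.
exact: (dloc2l (@lmul_smooth R r G) X pb (cdom_center one) pb1).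
Qed.

Lemma left_invariant_is_diff p b X : cdom p b ->
  is_diff (chart p b) (vfield_in p (left_invariant X))
    (fun h => 'd ('D_(row_mx 0 X) (loc2 (@lmul R r G) p one p))
       (row_mx (chart p b) o) (row_mx h 0)).
Proof.
move=> pb; set F := loc2 _ p one p.
have pb1 : cdom p (lmul b one) by rewrite lmulg1.
have oA := dom2_open (@lmul_smooth R r G) p one p.
have FA := loc2_Ck (@lmul_smooth R r G) p one p 2.
have Ab := dom2P pb (cdom_center one) pb1.
have dp := is_diff_row (is_diff_id (chart p b)) (is_diff_cst o (chart p b)).
have dv := is_diff_cst (row_mx (0 : 'rV[R]_r) X) (chart p b).
have D := is_diff_diff (p := fun y => row_mx y o) oA FA Ab dp dv.
have nI : \forall u \near chart p b, (chart p @` cdom p) u.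
  by apply: open_nbhs_nbhs; split; [exact: chart_image_open|exists b].
have nE : \forall u \near chart p b, 'd F (row_mx u o) (row_mx 0 X) =
    vfield_in p (left_invariant X) u.
  by apply: filterS nI => _ [c pc <-]; exact/esym/left_invariant_loc.
apply: is_diff_eq (is_diff_near nE D) _; apply/funext => h.
by apply: etrans (congr1 (fun x => _ + x) (linear0 _)) _; rewrite addr0.
Qed.

Lemma left_invariant_differentiable p b X : cdom p b ->
  differentiable (vfield_in p (left_invariant X)) (chart p b).
Proof. by move=> pb; exact: is_diff_differentiable (left_invariant_is_diff X pb). Qed.

Lemma left_invariant_related a X :
  related (lmul a) (left_invariant X) (@left_invariant R r G X).
Proof.
move=> b; rewrite /left_invariant -/one.
have E : @lmul R r G (lmul a b) = lmul a \o lmul b by apply/funext => c /=; rewrite lmulA.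
have h := tmap_comp one X (lmul_smoothl b) (lmul_smoothl a).
by rewrite lmulg1 in h; rewrite E; exact: esym h.
Qed.

(** Left translation by a relates each left-invariant field to itself, so [related_bracket] carries
    the bracket at 1 to the bracket at a. *)
Lemma left_invariant_bracket a X Y :
  vbracket (left_invariant X) (left_invariant Y) a = left_invariant (lie G X Y) a.
Proof.
have h := related_bracket (lmul_smoothl a) (left_invariant_related a X)
  (left_invariant_related a Y) (left_invariant_differentiable X (cdom_center one))
  (left_invariant_differentiable Y (cdom_center one))
  (left_invariant_differentiable X (cdom_center _))
  (left_invariant_differentiable Y (cdom_center _)).
by rewrite lmulg1 in h; exact: esym h.
Qed.

Let F := loc2 (@lmul R r G) one one one.

(* The mixed second derivative of the multiplication at (1, 1), in the chart
   centered at 1. *)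
Definition lie2 X Y := 'd ('D_(row_mx 0 Y) F) (row_mx o o) (row_mx X 0).

Lemma lieE X Y : lie G X Y = lie2 X Y - lie2 Y X.
Proof.
rewrite /lie /vbracket !left_invariant1.
by congr (_ - _); exact: is_diffE (left_invariant_is_diff _ (cdom_center one)) _.
Qed.

Lemma cdom_one_mul1 : cdom one (lmul one one).
Proof. by rewrite lmul1g; exact: cdom_center. Qed.

(** Moves Y from the direction of differentiation to the argument of a differential, where linearity
    is automatic. *)
Lemma lie2_sym X Y : lie2 X Y = 'd ('D_(row_mx X 0) F) (row_mx o o) (row_mx 0 Y).
Proof.
exact: Ck_derive_sym (dom2_open (@lmul_smooth R r G) one one one)
  (loc2_Ck (@lmul_smooth R r G) one one one 2)
  (dom2P (cdom_center one) (cdom_center one) cdom_one_mul1).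
Qed.

Lemma lie2_linearl Y : linear (lie2^~ Y).
Proof.
move=> k X X'; rewrite /lie2.
have -> : row_mx (k *: X + X') 0 = k *: row_mx X 0 + row_mx X' 0 :> 'rV[R]_(r + r).
  by rewrite scale_row_mx add_row_mx scaler0 addr0.
exact: linearP.
Qed.

Lemma lie2Zl k X Y : lie2 (k *: X) Y = k *: lie2 X Y.
Proof.
rewrite /lie2.
have -> : row_mx (k *: X) 0 = k *: row_mx X 0 :> 'rV[R]_(r + r).
  by rewrite scale_row_mx scaler0.
exact: linearZ.
Qed.

Lemma lie2_linearr X : linear (lie2 X).
Proof.
move=> k Y Y'; rewrite !lie2_sym.
have -> : row_mx 0 (k *: Y + Y') = k *: row_mx 0 Y + row_mx 0 Y' :> 'rV[R]_(r + r).
  by rewrite scale_row_mx add_row_mx scaler0 addr0.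
exact: linearP.
Qed.

Lemma lie_linearr X : linear (lie G X).
Proof.
move=> k Y Y'; rewrite !lieE.
have alg (x y x' y' : 'rV[R]_r) :
    (k *: x + x') - (k *: y + y') = k *: (x - y) + (x' - y').
  by rewrite scalerBr opprD addrACA.
apply: etrans _ (alg _ _ _ _).
by congr (_ - _); [exact: lie2_linearr|exact: lie2_linearl].
Qed.

Lemma lieC X Y : lie G X Y = - lie G Y X.
Proof. by rewrite !lieE opprB. Qed.

Lemma lie_linearl Y : linear ((lie G)^~ Y).
Proof.
move=> k X X' /=; rewrite !(lieC _ Y); apply: etrans (congr1 -%R (lie_linearr _ _ _ _)) _.
by rewrite opprD scalerN.
Qed.

(** Conjugation by a is an automorphism, so it intertwines the left translations by b and by
    [conjl a b]. *)
Lemma Ad_related a X :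
  related (conjl a) (left_invariant X) (left_invariant (Ad a X)).
Proof.
move=> b; rewrite /left_invariant -/one.
have h1 := tmap_comp one X (lmul_smoothl b) (conjl_smooth a).
rewrite lmulg1 in h1.
have h2 := tmap_comp one X (conjl_smooth a) (lmul_smoothl (conjl a b)).
rewrite conjl1 in h2.
apply: etrans (esym h1) _; apply: etrans _ h2.
suff -> : conjl a \o lmul b = lmul (conjl a b) \o conjl a by [].
by apply/funext => c /=; rewrite conjlM.
Qed.

Lemma Ad_lie a X Y : Ad a (lie G X Y) = lie G (Ad a X) (Ad a Y).
Proof.
have h := related_bracket (conjl_smooth a) (Ad_related a X) (Ad_related a Y)
  (left_invariant_differentiable X (cdom_center one))
  (left_invariant_differentiable Y (cdom_center one))
  (left_invariant_differentiable _ (cdom_center _))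
  (left_invariant_differentiable _ (cdom_center _)).
by rewrite conjl1 in h; exact: h.
Qed.

Section Exponential.
Variable ex : 'rV[R]_r -> G.
Hypothesis exP : is_exponential ex.

Lemma ex0 : ex 0 = one.
Proof.
have [_ /(_ 0 0) h _] := exP 0; rewrite !scaler0 in h.
have := congr1 (lmul (linv (ex 0))) h.
by rewrite lmulVg lmulA lmulVg lmul1g.
Qed.

Lemma exN t X : linv (ex (t *: X)) = ex (- t *: X).
Proof.
have [_ /(_ t (- t)) h _] := exP X; rewrite subrr scale0r ex0 in h.
have := congr1 (lmul (linv (ex (t *: X)))) h.
by rewrite lmulA lmulVg lmul1g lmulg1.
Qed.

Lemma ex_near X : \forall t \near (0 : R^o), cdom one (ex (t *: X)).
Proof.
have [[cX _] _ _] := exP X.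
have : \forall b \near ex (0 *: X), cdom one b.
  by apply: cdom_near; rewrite scale0r ex0; exact: cdom_center.
exact: cX.
Qed.

Lemma exp_diff X : is_diff (0 : R^o) (fun t : R^o => chart one (ex (t *: X)))
  (fun h => h *: X).
Proof.
have [[cX sX] _ dX] := exP X.
have D : differentiable (fun t : R^o => chart one (ex (t *: X))) (0 : R^o).
  have [+ _] := sX one 1%N; apply.
  by rewrite /= scale0r ex0; exact: cdom_center.
apply: is_diff_eq (is_diffI D) _; apply/funext => h.
have lz : 'd (fun t : R^o => chart one (ex (t *: X))) (0 : R^o) (h *: (1 : R^o)) =
    h *: 'd (fun t : R^o => chart one (ex (t *: X))) (0 : R^o) (1 : R^o).
  exact: linearZ.
have h1 : h *: (1 : R^o) = h by exact: mulr1.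
rewrite h1 in lz; apply: etrans lz _; congr (_ *: _).
by apply: etrans dX; exact/esym/deriveE.
Qed.

Lemma exp_diffN X : is_diff (0 : R^o) (fun t : R^o => chart one (ex (- t *: X)))
  (fun h => - (h *: X)).
Proof.
have N : is_diff (0 : R^o) (fun t : R^o => - t) (fun h => - h).
  by apply: is_diffN; exact: is_diff_id.
have E : is_diff (- (0 : R^o)) (fun t : R^o => chart one (ex (t *: X)))
  (fun h => h *: X) by rewrite oppr0; exact: exp_diff.
apply: is_diff_eq (is_diff_comp N E) _.
by apply/funext => h /=; rewrite scaleNr.
Qed.

End Exponential.
End LieTheory.

(** * The derivative of Ad and the Jacobi identity *)

Section AdDerivative.
Context {R : realType} {r : nat} (G : lieGroup R r) (ex : 'rV[R]_r -> G).
Hypothesis exP : is_exponential ex.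
Implicit Types (X Y Z : 'rV[R]_r) (a b c : G).

Let one : G := lone G.
Let o := chart one one.
Let F := loc2 (@lmul R r G) one one one.
Let lms := @lmul_smooth R r G.

Let oA : open (dom2 (@lmul R r G) one one one) := dom2_open lms one one one.
Let FA : Ck 2 (dom2 (@lmul R r G) one one one) F := loc2_Ck lms one one one 2.
Let Aoo : dom2 (@lmul R r G) one one one (row_mx o o) :=
  dom2P (cdom_center one) (cdom_center one) (cdom_one_mul1 G).

Let dFl v : 'd F (row_mx o o) (row_mx v 0) = v.
Proof.
have E : (@lmul R r G)^~ one = id by apply/funext => b; rewrite lmulg1.
have h := dloc2r lms v (cdom_center one) (cdom_center one) (cdom_one_mul1 G).
apply: etrans (esym h) _; rewrite E; exact: dloc_id (cdom_center one).
Qed.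

Let dFr v : 'd F (row_mx o o) (row_mx 0 v) = v.
Proof.
have E : @lmul R r G one = id by apply/funext => b; rewrite lmul1g.
have h := dloc2l lms v (cdom_center one) (cdom_center one) (cdom_one_mul1 G).
apply: etrans (esym h) _; rewrite E; exact: dloc_id (cdom_center one).
Qed.

(** On the slice (u, 1) the multiplication is u itself, so its derivative in the direction (Y, 0) is
    constantly Y there. *)
Let ddFl X Y : 'd ('D_(row_mx Y 0) F) (row_mx o o) (row_mx X 0) = 0.
Proof.
have D1 := Ck_is_diff (CkD (row_mx Y 0) FA) Aoo.
have dp := is_diff_row (is_diff_id o) (is_diff_cst o o).
have D2 := is_diff_comp (f := fun u => row_mx u o) dp D1.
have nI : \forall u \near o, (chart one @` cdom one) u.
  by apply: open_nbhs_nbhs; split; [exact: chart_image_open|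
    exists one => //; exact: cdom_center].
have nE : \forall u \near o, ('D_(row_mx Y 0) F \o (fun u => row_mx u o)) u = Y.
  apply: filterS nI => _ [b ob <-] /=.
  have ob1 : cdom one (lmul b one) by rewrite lmulg1.
  have Ab := dom2P ob (cdom_center one) ob1.
  apply: etrans (is_diff_derive _ (Ck_is_diff FA Ab)) _.
  have E : (@lmul R r G)^~ one = id by apply/funext => c; rewrite lmulg1.
  have h := dloc2r lms Y ob (cdom_center one) ob1.
  by apply: etrans (esym h) _; rewrite E; exact: dloc_id ob.
have C := is_diffE (is_diff_near nE D2) X.
by apply: etrans (esym C) _; exact: is_diffE (is_diff_cst Y o) X.
Qed.

(* Ad (ex (t X)) Y = d_1 mu (g t, g (- t)) (d_2 mu (g t, 1) Y), where mu is the
   multiplication and g t = ex (t X). *)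
Lemma Ad_diff X Y : is_diff (0 : R^o) (fun t : R^o => Ad (ex (t *: X)) Y)
  (fun h => h *: lie G X Y).
Proof.
pose g (t : R^o) := chart one (ex (t *: X)).
pose g' (t : R^o) := chart one (ex (- t *: X)).
have g0 : g 0 = o by rewrite /g scale0r (ex0 exP).
have g'0 : g' 0 = o by rewrite /g' oppr0 scale0r (ex0 exP).
have dg : is_diff (0 : R^o) g (fun h => h *: X) := exp_diff exP X.
have dg' : is_diff (0 : R^o) g' (fun h => - (h *: X)) := exp_diffN exP X.
have dv := is_diff_cst (row_mx (0 : 'rV[R]_r) Y) (0 : R^o).
have dp1 := is_diff_row dg (is_diff_cst o (0 : R^o)).
have A1 : dom2 (@lmul R r G) one one one (row_mx (g 0) o) by rewrite g0.
have A2 : dom2 (@lmul R r G) one one one (row_mx (g 0) (g' 0)) by rewrite g0 g'0.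
pose V (t : R^o) := 'd F (row_mx (g t) o) (row_mx 0 Y).
have V0 : V 0 = Y by rewrite /V g0; exact: dFr.
have dV : is_diff (0 : R^o) V (fun h => lie2 G (h *: X) Y).
  apply: is_diff_eq (is_diff_diff (p := fun t => row_mx (g t) o) oA FA A1 dp1 dv) _.
  apply/funext => h; rewrite g0.
  rewrite /lie2 -[RHS]addr0; congr (_ + _); exact: linear0.
have dv2 := is_diff_row dV (is_diff_cst (0 : 'rV[R]_r) (0 : R^o)).
have dp2 := is_diff_row dg dg'.
have D := is_diff_diff (p := fun t => row_mx (g t) (g' t))
  (v := fun t => row_mx (V t) 0) oA FA A2 dp2 dv2.
have nE : \forall t \near (0 : R^o), 'd F (row_mx (g t) (g' t)) (row_mx (V t) 0) =
    Ad (ex (t *: X)) Y.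
  have n1 := ex_near exP X.
  have n2 : \forall t \near (0 : R^o), cdom one (ex (- t *: X)).
    have cN : {for (0 : R^o), continuous (fun t : R^o => - t)}.
      exact: continuousN.
    have n1' : \forall t \near - (0 : R^o), cdom one (ex (t *: X)).
      by rewrite oppr0; exact: ex_near exP X.
    exact: cN n1'.
  apply: filterS2 n1 n2 => t at1 at2.
  have ai : linv (ex (t *: X)) = ex (- t *: X) := exN exP t X.
  set a := ex (t *: X) in at1 ai *.
  have ai1 : cdom one (linv a) by rewrite ai.
  have a1 : cdom one (lmul a one) by rewrite lmulg1.
  have aa1 : cdom one (lmul (lmul a one) (linv a)).
    by rewrite lmulg1 lmulgV; exact: cdom_center.
  have aa : cdom one (lmul a (linv a)) by rewrite lmulgV; exact: cdom_center.
  have AdE : Ad a Y = dloc (conjl a) one one one Y.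
    rewrite /Ad; have c1 := conjl1 a; rewrite -/(conjl a).
    by rewrite /tmap -[in chart (conjl a _)]/one c1.
  have h1 := dloc_comp Y (lmul_smoothl a) (lmul_smoothr (linv a))
    (cdom_center one) a1 aa1.
  rewrite lmulg1 in h1.
  have h2 := dloc2l lms Y at1 (cdom_center one) a1.
  have h3 := dloc2r lms (V t) at1 ai1 aa.
  have h12 := congr1 (dloc ((@lmul R r G)^~ (linv a)) one one a) h2.
  have hg' : g' t = chart one (linv a) by rewrite ai.
  rewrite hg' AdE; apply: etrans _ (esym h1).
  exact: esym (etrans h12 h3).
apply: is_diff_eq (is_diff_near nE D) _; apply/funext => h /=.
rewrite V0 g0 g'0.
(* The base point (g t, g(-t)) moves with velocity (X, -X). Its first half contributes nothing by
   [ddFl], its second half gives [- lie2 G Y X] by symmetry, and the motion of V gives [lie2 G X Y];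
   together they form the bracket. *)
have -> : row_mx (h *: X) (- (h *: X)) = h *: row_mx X 0 - h *: row_mx 0 X :> 'rV[R]_(r + r).
  by rewrite !scale_row_mx !scaler0 opp_row_mx add_row_mx subr0 add0r.
have e1 : 'd ('D_(row_mx Y 0) F) (row_mx o o) (h *: row_mx X 0 - h *: row_mx 0 X) =
    - (h *: lie2 G Y X).
  have lB := linearB ('d ('D_(row_mx Y 0) F) (row_mx o o)) (h *: row_mx X 0) (h *: row_mx 0 X).
  have l1 : 'd ('D_(row_mx Y 0) F) (row_mx o o) (h *: row_mx X 0) = 0.
    apply: etrans (linearZ _ _) _.
    exact: etrans (congr1 (fun v => h *: v) (ddFl X Y)) (scaler0 _ _).
  have l2 : 'd ('D_(row_mx Y 0) F) (row_mx o o) (h *: row_mx 0 X) = h *: lie2 G Y X.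
    apply: etrans (linearZ _ _) _; congr (_ *: _); exact: esym (lie2_sym G Y X).
  apply: etrans lB _; apply: etrans (congr2 (fun x y => x - y) l1 l2) _.
  by rewrite add0r.
have e2 : 'd F (row_mx o o) (row_mx (lie2 G (h *: X) Y) 0) = h *: lie2 G X Y.
  apply: etrans (dFl _) _.
  exact: lie2Zl.
rewrite lieE scalerBr addrC.
apply: etrans (congr2 +%R e2 e1) _; reflexivity.
Qed.

(** The infinitesimal form of an invariance under [Ad]; with f the projection onto k it places
    [k, m] in m. *)
Lemma linear_Ad_lie (W : normedModType R) (f : {linear 'rV[R]_r -> W}) X Y w :
  (forall t : R, f (Ad (ex (t *: X)) Y) = w) -> f (lie G X Y) = 0.
Proof.
move=> fE.
have D := is_diff_comp (Ad_diff X Y) (is_diff_linear f (Ad (ex ((0 : R^o) *: X)) Y)).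
have E : f \o (fun t : R^o => Ad (ex (t *: X)) Y) = cst w.
  by apply/funext => t; exact: fE.
rewrite E in D.
have := is_diffE D (1 : R^o); rewrite /= scale1r => <-.
exact: is_diffE (is_diff_cst w (0 : R^o)) _.
Qed.

Lemma Ad_one Y : Ad (ex ((0 : R^o) *: 0)) Y = Y.
Proof.
rewrite scaler0 (ex0 exP) /Ad -/one -/(conjl one).
have -> : conjl one = id.
  apply/funext => b; rewrite /conjl lmul1g.
  by have := lmulVg one; rewrite lmulg1 => ->; rewrite lmulg1.
exact: dloc_id (cdom_center one).
Qed.

Lemma Ad_zero X Y : Ad (ex ((0 : R^o) *: X)) Y = Y.
Proof. by rewrite scale0r -{2}(Ad_one Y) scale0r. Qed.

(* Obtained by differentiating Ad (ex (t X)) [Y, Z]. *)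
Lemma lie_jacobi X Y Z :
  lie G X (lie G Y Z) = lie G (lie G X Y) Z + lie G Y (lie G X Z).
Proof.
have D1 := Ad_diff X (lie G Y Z).
have D2 := is_diff_bilinear (@lie_linearl R r G) (@lie_linearr R r G)
  (Ad_diff X Y) (Ad_diff X Z).
have E : (fun t : R^o => Ad (ex (t *: X)) (lie G Y Z)) =
   fun t : R^o => lie G (Ad (ex (t *: X)) Y) (Ad (ex (t *: X)) Z).
  by apply/funext => t; exact: Ad_lie.
rewrite E in D1.
have := etrans (esym (is_diffE D1 (1 : R^o))) (is_diffE D2 (1 : R^o)).
by rewrite /= !scale1r !Ad_zero addrC.
Qed.

End AdDerivative.

(** * Smooth actions and orbit maps *)

Section Action.
Context {R : realType} {r d : nat} {G : lieGroup R r} {M : manifold R d}.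
Variables (act : G -> M -> M) (ex : 'rV[R]_r -> G).
Hypothesis exP : is_exponential ex.
Hypothesis actP : smooth_action act.
Implicit Types (X Y Z : 'rV[R]_r) (a b c : G).

Let one : G := lone G.
Let acts : smooth_map2 act. Proof. by case: actP. Qed.
Let act1 z : act one z = z. Proof. by case: actP. Qed.
Let actM a b z : act (lmul a b) z = act a (act b z). Proof. by case: actP. Qed.

Lemma act_smooth_l a : smooth_map (act a).
Proof. exact: smooth_map2l acts a. Qed.

Lemma orbit_smooth z : smooth_map (act^~ z).
Proof. exact: smooth_map2r acts z. Qed.

(** Replaces the exponential map by the differential of the orbit map, an expression visibly linear
    in X. *)
Lemma fundamental_fieldE X z : fundamental_field act ex X z = tmap (act^~ z) one X.
Proof.
have z1 : cdom z (act one z) by rewrite act1; exact: cdom_center.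
pose g (t : R^o) := chart one (ex (t *: X)).
have g0 : g 0 = chart one one by rewrite /g scale0r (ex0 exP).
have D1 := is_diff_loc (orbit_smooth z) (cdom_center one) z1.
rewrite -g0 in D1.
have D2 := is_diff_comp (f := g) (exp_diff exP X) D1.
have nE : \forall t \near (0 : R^o), ((chart z \o act^~ z \o cinv one) \o g) t =
    chart z (act (ex (t *: X)) z).
  by apply: filterS (ex_near exP X) => t ot; rewrite /g /= chartK.
apply: etrans (is_diff_derive (1 : R^o) (is_diff_near nE D2)) _.
by rewrite /= scale1r /tmap -/one act1.
Qed.

Lemma orbit_left_invariant z b X :
  tmap (act^~ z) b (left_invariant X b) = tmap (act b) z (tmap (act^~ z) one X).
Proof.
have h1 := tmap_comp one X (lmul_smoothl b) (orbit_smooth z).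
rewrite lmulg1 in h1.
have h2 := tmap_comp one X (orbit_smooth z) (act_smooth_l b).
rewrite act1 in h2.
apply: etrans (esym h1) _; apply: etrans _ h2.
suff -> : act^~ z \o lmul b = act b \o act^~ z by [].
by apply/funext => c /=; rewrite actM.
Qed.

(** When a fixes z, a(cz) = (a c a^-1) z: the orbit map of z intertwines conjugation by a with the
    action of a. *)
Lemma orbit_Ad z a X : act a z = z ->
  tmap (act a) z (tmap (act^~ z) one X) = tmap (act^~ z) one (Ad a X).
Proof.
move=> az.
have h1 := tmap_comp one X (orbit_smooth z) (act_smooth_l a).
rewrite act1 in h1.
have h2 := tmap_comp one X (conjl_smooth a) (orbit_smooth z).
rewrite conjl1 in h2.
apply: etrans (esym h1) _; apply: etrans _ h2.
suff -> : act a \o act^~ z = act^~ z \o conjl a by [].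
have iz : act (linv a) z = z by rewrite -{1}az -actM lmulVg act1.
by apply/funext => c /=; rewrite /conjl !actM iz.
Qed.

End Action.

(** * Lifting vector fields to the group *)

Section CoordinateFields.
Context {R : realType} {d : nat} {M : manifold R d}.
Implicit Types (y z : M) (u v : 'rV[R]_d) (w : two_form M).

(* The vector field with constant components v in the chart of index y,
   meaningful on cdom y only. *)
Definition coord_field y v z : 'rV[R]_d := dloc id y z z v.

Lemma coord_field_loc y v z p : cdom y z -> cdom p z ->
  dloc id z p z (coord_field y v z) = dloc id y p z v.
Proof.
move=> yz pz; have h := @dloc_comp _ _ _ _ _ _ _ id id y z p z v
  (smooth_id M) (smooth_id M) yz (cdom_center z) pz.
exact: esym h.
Qed.

Lemma coord_fieldK y z v : cdom y z -> coord_field y (dloc id z y z v) z = v.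
Proof.
move=> yz; have h := @dloc_comp _ _ _ _ _ _ _ id id z y z z v
  (smooth_id M) (smooth_id M) (cdom_center z) yz (cdom_center z).
by apply: etrans (esym h) _; exact: dloc_id (cdom_center z).
Qed.

Lemma coord_field_center y v : coord_field y v y = v.
Proof. exact: dloc_id (cdom_center y). Qed.

Lemma coord_field_smooth y v : smooth_vfield (cdom y) (coord_field y v).
Proof.
move=> p k.
have oA : open (chart p @` (cdom y `&` cdom p)).
  by rewrite setIC; apply: open_chart; exact: cdom_open.
have C1 : Ck k (chart p @` (cdom y `&` cdom p)) (chart y \o id \o cinv p).
  by rewrite setIC; exact: smooth_Ck (smooth_id M).
have C2 := CkD v (smooth_Ck y p k.+1 (smooth_id M)).
apply: (Ck_ext oA) (Ck_comp oA _ C1 C2).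
  move=> _ [z [yz pz] <-]; rewrite vfield_inE//.
  have py := is_diff_loc (smooth_id M) yz pz.
  rewrite coord_field_loc// /= chartK//.
  exact: is_diff_derive py.
by move=> _ [z [yz pz] <-]; rewrite /= chartK//; exists z.
Qed.

(** With p the matrix of the P i and q that of the functionals g(-, Q j), duality says p q = 1. Both
    being square, q p = 1 as well, and v = v q p is the expansion. *)
Lemma gram_basis (g : {biscalar 'rV[R]_d}) (P Q : 'I_d -> 'rV[R]_d) v :
  (forall i j, g (P i) (Q j) = (i == j)%:R) -> v = \sum_i g v (Q i) *: P i.
Proof.
move=> gPQ.
pose p : 'M[R]_d := \matrix_i P i.
pose q : 'M[R]_d := \matrix_(l, j) g (delta_mx ord0 l) (Q j).
have gE u j : g u (Q j) = (u *m q) ord0 j.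
  rewrite {1}[u]row_sum_delta linear_sumlz !mxE; apply: eq_bigr => l _.
  by rewrite linearZl_LR !mxE.
have pq : p *m q = 1%:M.
  apply/matrixP => i j; rewrite [RHS]mxE -[(i == j)%:R]gPQ gE !mxE.
  by apply: eq_bigr => l _; rewrite !mxE.
rewrite -{1}[v]mulmx1 -(mulmx1C pq) mulmxA.
rewrite [LHS]mulmx_sum_row; apply: eq_bigr => i _.
by rewrite gE rowK.
Qed.

End CoordinateFields.

Section Lift.
Context {R : realType} {r d : nat} {G : lieGroup R r} {M : manifold R d}.
Variables (act : G -> M -> M).
Hypothesis actP : smooth_action act.
Variables (x : M) (a : G).

Let one : G := lone G.
Let orb := act^~ x.
Let D X := tmap orb one X.
Let orbs : smooth_map orb := orbit_smooth actP x.
Let y := act a x.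
Let u0 := chart a a.

(** A vector at b x that depends on b and not on b x alone, since the isotropy group may rotate the
    tangent space at x. This is why coefficients with respect to such vectors are functions on G. *)
Definition push X b := tmap (act b) x (D X).

Lemma push_left X b : tmap orb b (left_invariant X b) = push X b.
Proof. exact: orbit_left_invariant actP x b X. Qed.

Lemma push_linear b : linear (push^~ b).
Proof. by move=> k X Y; rewrite /push /D !linearP. Qed.

Lemma is_diff_pull (W : normedModType R) (f : M -> W) q (L : 'rV[R]_d -> W) :
  cdom q y -> is_diff (chart q y) (f \o cinv q) L ->
  is_diff u0 ((f \o orb) \o cinv a) (L \o dloc orb a q a).
Proof.
move=> qy df.
have dF := is_diff_loc orbs (cdom_center a) qy.
have e : (chart q \o orb \o cinv a) (chart a a) = chart q y.
  by rewrite /= chartK//; exact: cdom_center.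
rewrite -e in df; have C := is_diff_comp dF df.
have nE : \forall u \near u0, ((f \o cinv q) \o (chart q \o orb \o cinv a)) u =
    ((f \o orb) \o cinv a) u.
  apply: (cinv_near (P := fun b => f (cinv q (chart q (orb b))) = f (orb b)) (cdom_center a)).
  have n : \forall b \near a, cdom q (orb b) by exact: orbs.1 a _ (cdom_near qy).
  by apply: filterS n => b qb; rewrite chartK.
exact: is_diff_near nE C.
Qed.

Section Bracket.
Variables (I : finType) (X : I -> 'rV[R]_r) (c : I -> G -> R^o).
Hypothesis cd : forall i, differentiable (c i \o cinv a) u0.

Definition orbit_lift b := \sum_i c i b *: left_invariant (X i) b.

Lemma orbit_lift_related (A : M -> 'rV[R]_d) :
  (forall b, A (orb b) = \sum_i c i b *: push (X i) b) -> related orb orbit_lift A.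
Proof.
move=> AE b; rewrite AE /orbit_lift linear_sum; apply: eq_bigr => i _.
by rewrite linearZ /= push_left.
Qed.

Lemma orbit_lift_is_diff : is_diff u0 (vfield_in a orbit_lift)
  (fun h => \sum_i (c i a *: 'd (vfield_in a (left_invariant (X i))) u0 h +
    'd (c i \o cinv a) u0 h *: left_invariant (X i) a)).
Proof.
have vE : vfield_in a orbit_lift = fun u => \sum_i (c i \o cinv a) u *:
    vfield_in a (left_invariant (X i)) u.
  apply/funext => u; rewrite {1}/vfield_in /orbit_lift linear_sum.
  by apply: eq_bigr => i _; rewrite linearZ.
have D1 i : is_diff u0 (fun u => (c i \o cinv a) u *:
    vfield_in a (left_invariant (X i)) u) _ :=
  is_diff_scale (is_diffI (cd i))
   (is_diffI (left_invariant_differentiable (X i) (cdom_center a))).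
rewrite vE; apply: is_diff_eq (is_diff_sum D1) _.
apply/funext => h; apply: eq_bigr => i _.
by rewrite /u0 /= chartK ?vfield_in_center//; exact: cdom_center.
Qed.

End Bracket.

(** On G this is the Leibniz rule for combinations of left-invariant fields, whose own brackets are
    left-invariant again; the orbit map then carries the result to y. *)
Lemma bracket_lift (I : finType) (X Y : I -> 'rV[R]_r) (c e : I -> G -> R^o)
    (A B : M -> 'rV[R]_d) :
  (forall i, differentiable (c i \o cinv a) u0) ->
  (forall i, differentiable (e i \o cinv a) u0) ->
  (forall b, A (orb b) = \sum_i c i b *: push (X i) b) ->
  (forall b, B (orb b) = \sum_i e i b *: push (Y i) b) ->
  differentiable (vfield_in y A) (chart y y) ->
  differentiable (vfield_in y B) (chart y y) ->
  vbracket A B y =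
    \sum_i \sum_j (c i a * e j a) *: push (lie G (X i) (Y j)) a
    + \sum_j 'd (e j \o cinv a) u0 (orbit_lift X c a) *: push (Y j) a
    - \sum_i 'd (c i \o cinv a) u0 (orbit_lift Y e a) *: push (X i) a.
Proof.
move=> cd ed AE BE dA dB.
have dX := orbit_lift_is_diff X cd; have dY := orbit_lift_is_diff Y ed.
have h := related_bracket orbs (orbit_lift_related AE) (orbit_lift_related BE)
  (is_diff_differentiable dX) (is_diff_differentiable dY) dA dB.
apply: etrans (esym h) _.
have vE : vbracket (orbit_lift X c) (orbit_lift Y e) a =
    \sum_i \sum_j (c i a * e j a) *: left_invariant (lie G (X i) (Y j)) a
    + \sum_j 'd (e j \o cinv a) u0 (orbit_lift X c a) *: left_invariant (Y j) a
    - \sum_i 'd (c i \o cinv a) u0 (orbit_lift Y e a) *: left_invariant (X i) a.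
  pose dl Z h := 'd (vfield_in a (left_invariant Z)) u0 h.
  have e1 : \sum_j e j a *: dl (Y j) (orbit_lift X c a) =
      \sum_i \sum_j (c i a * e j a) *: dl (Y j) (left_invariant (X i) a).
    rewrite exchange_big /=; apply: eq_bigr => j _.
    apply: etrans (congr1 (fun v => _ *: v) (linear_sum _ _ _ _)) _.
    rewrite scaler_sumr; apply: eq_bigr => i _.
    apply: etrans (congr1 (fun v => _ *: v) (linearZ _ _)) _.
    by rewrite scalerA mulrC.
  have e2 : \sum_i c i a *: dl (X i) (orbit_lift Y e a) =
      \sum_i \sum_j (c i a * e j a) *: dl (X i) (left_invariant (Y j) a).
    apply: eq_bigr => i _.
    apply: etrans (congr1 (fun v => _ *: v) (linear_sum _ _ _ _)) _.
    rewrite scaler_sumr; apply: eq_bigr => j _.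
    apply: etrans (congr1 (fun v => _ *: v) (linearZ _ _)) _.
    by rewrite scalerA.
  have v1 := is_diffE dY (orbit_lift X c a); have v2 := is_diffE dX (orbit_lift Y e a).
  apply: etrans (congr2 (fun s t => s - t) v1 v2) _.
  rewrite !big_split /=.
  have alg (s s' p q t : 'rV[R]_r) : s - s' = t -> (s + p) - (s' + q) = t + p - q.
    by move=> <-; rewrite opprD addrACA addrA.
  apply: alg; apply: etrans (congr2 (fun s t => s - t) e1 e2) _.
  rewrite -sumrB; apply: eq_bigr => i _; rewrite -sumrB; apply: eq_bigr => j _.
  rewrite -scalerBr; congr (_ *: _).
  exact: left_invariant_bracket.
rewrite vE linearB linearD /=; congr (_ + _ - _); rewrite linear_sum.
- apply: eq_bigr => i _; rewrite linear_sum; apply: eq_bigr => j _.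
  by rewrite linearZ/= push_left.
- by apply: eq_bigr => j _; rewrite linearZ/= push_left.
- by apply: eq_bigr => i _; rewrite linearZ/= push_left.
Qed.

End Lift.

(** * The Nijenhuis tensor and closedness in terms of the Lie bracket *)

Section Homogeneous.
Context {R : realType} {r d : nat} {G : lieGroup R r} {M : manifold R d}.
Variables (w : two_form M) (J : endo_field M) (act : G -> M -> M).
Hypotheses (wP : symplectic w) (JP : almost_complex J)
  (actP : smooth_action act) (act_w : preserves_form act w)
  (act_J : preserves_endo act J).
Variables (x : M) (H : 'rV[R]_r -> 'rV[R]_r) (e : 'I_d -> 'rV[R]_r).

Let D X := tmap (act^~ x) (lone G) X.
Hypothesis HJ : forall X, J x (D X) = D (H X).
Hypothesis e_orth : forall i j, w x (D (e i)) (D (H (e j))) = (i == j)%:R.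

Lemma push_w X Y b : w (act b x) (push act x X b) (push act x Y b) = w x (D X) (D Y).
Proof. exact: act_w. Qed.

Lemma push_J X b : J (act b x) (push act x X b) = push act x (H X) b.
Proof. by rewrite /push act_J HJ. Qed.

(** The metric product with the i-th pushed vector; H enters because g(u, v) = w(u, Jv). *)
Definition frame_coef (A : M -> 'rV[R]_d) i b : R^o :=
  w (act b x) (A (act b x)) (push act x (H (e i)) b).

Lemma frame_coefE A b : A (act b x) = \sum_i frame_coef A i b *: push act x (e i) b.
Proof. by apply: gram_basis => i j; rewrite push_w. Qed.

(** J acts on the frame only, so A and JA have the same coefficients; the cancellations in
    [nijenhuis_push] rest on this. *)
Lemma frame_coefJ A b :
  J (act b x) (A (act b x)) = \sum_i frame_coef A i b *: push act x (H (e i)) b.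
Proof.
rewrite {1}frame_coefE linear_sum; apply: eq_bigr => i _.
by rewrite linearZ /= push_J.
Qed.

Variable a : G.
Let y := act a x.
Let orb := act^~ x.
Let orbs : smooth_map orb := orbit_smooth actP x.

(** Near a the coefficient is a sum of products of three kinds of functions in fixed charts:
    components of A, components of the differential of the orbit map applied to a left-invariant
    field (these are the components of [push]), and the entries W of the matrix of w on coordinate
    fields. *)
Lemma frame_coef_differentiable A i : differentiable (vfield_in y A) (chart y y) ->
  differentiable (frame_coef A i \o cinv a) (chart a a).
Proof.
move=> dA; set X := H (e i).
have yy : cdom y y by exact: cdom_center.
have aa : cdom a a by exact: cdom_center.
have nI : \forall u \near chart y y, (chart y @` cdom y) u.
  by apply: open_nbhs_nbhs; split; [exact: chart_image_open|exists y].
have d1 : is_diff (chart y y) ((vfield_in y A \o chart y) \o cinv y)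
    ('d (vfield_in y A) (chart y y)).
  apply: is_diff_near (is_diffI dA).
  by apply: filterS nI => u yu /=; rewrite cinvK.
have d1' := is_diff_pull actP yy d1.
pose W j l (z : M) : R^o := w z (coord_field y (delta_mx ord0 j) z)
   (coord_field y (delta_mx ord0 l) z).
have d2 j l : is_diff (chart y y) (W j l \o cinv y) ('d (W j l \o cinv y) (chart y y)).
  have [ws _ _ _] := wP.
  have := ws _ _ _ (@cdom_open _ _ M y) (coord_field_smooth y (delta_mx ord0 j))
    (coord_field_smooth y (delta_mx ord0 l)) y 1%N.
  by move=> C; apply: (Ck_is_diff C); exists y.
have d2' j l := is_diff_pull actP yy (d2 j l).
pose F := chart y \o orb \o cinv a.
pose S := chart a @` (cdom a `&` orb @^-1` cdom y).
have oS : open S by exact: smooth_open orbs.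
have FS : Ck 2 S F by exact: smooth_Ck orbs.
have Sa : S (chart a a) by exists a.
have d3 := is_diff_diff oS FS Sa (is_diff_id (chart a a))
  (is_diffI (left_invariant_differentiable X aa)).
have T := is_diff_sum (fun j => is_diff_scale (is_diff_coord j d1')
  (is_diff_sum (fun l => is_diff_scale (is_diff_coord l d3) (d2' j l)))).
have nS : \forall u \near chart a a, S u by exact: open_nbhs_nbhs.
apply: is_diff_differentiable (is_diff_near _ T).
apply: filterS nS => _ [b [ab yb] <-].
rewrite /frame_coef /= chartK// -/X.
have zb : A (orb b) = coord_field y (vfield_in y A (chart y (orb b))) (orb b).
  by rewrite vfield_inE// coord_fieldK.
have pb : push act x X b =
    coord_field y ('d F (chart a b) (vfield_in a (left_invariant X) (chart a b))) (orb b).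
  rewrite vfield_inE//.
  have h := tmap_loc (left_invariant X b) orbs ab yb.
  apply: etrans _ (esym (congr1 (fun v => coord_field y v (orb b)) h)).
  rewrite coord_fieldK//; exact: esym (push_left actP x X b).
rewrite {1}zb pb; set al := vfield_in y A _; set be := 'd F _ _.
have cE v : coord_field y v (orb b) =
    \sum_j v ord0 j *: coord_field y (delta_mx ord0 j) (orb b).
  exact: linear_rVE (dloc id y (orb b) (orb b)) v.
rewrite (cE al) linear_sumlz; apply: eq_bigr => j _.
rewrite linearZl_LR /=; congr (_ * _).
rewrite (cE be) linear_sumr; apply: eq_bigr => l _.
by rewrite linearZr_LR.
Qed.

Lemma smooth_vfield_differentiable U A : U y -> smooth_vfield U A ->
  differentiable (vfield_in y A) (chart y y).
Proof.
move=> Uy As; apply: is_diff_differentiable (Ck_is_diff (As y 1%N) _).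
by exists y => //; split=> //; exact: cdom_center.
Qed.

Lemma nijenhuis_push U A B : open U -> U y -> smooth_vfield U A -> smooth_vfield U B ->
  nijenhuis J A B y = 4^-1 *: \sum_i \sum_j (frame_coef A i a * frame_coef B j a) *:
    push act x (lie G (H (e i)) (H (e j)) - H (lie G (H (e i)) (e j))
      - H (lie G (e i) (H (e j))) - lie G (e i) (e j)) a.
Proof.
move=> oU Uy As Bs.
pose JA z := J z (A z); pose JB z := J z (B z).
have JAs : smooth_vfield U JA by exact: JP.1.
have JBs : smooth_vfield U JB by exact: JP.1.
have dA := smooth_vfield_differentiable Uy As.
have dB := smooth_vfield_differentiable Uy Bs.
have dJA := smooth_vfield_differentiable Uy JAs.
have dJB := smooth_vfield_differentiable Uy JBs.
have cA i := frame_coef_differentiable i dA; have cB i := frame_coef_differentiable i dB.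
have b1 := bracket_lift actP cA cB (frame_coefJ A) (frame_coefJ B) dJA dJB.
have b2 := bracket_lift actP cA cB (frame_coefJ A) (frame_coefE B) dJA dB.
have b3 := bracket_lift actP cA cB (frame_coefE A) (frame_coefJ B) dA dJB.
have b4 := bracket_lift actP cA cB (frame_coefE A) (frame_coefE B) dA dB.
rewrite /nijenhuis -/JA -/JB; congr (_ *: _).
(* p and q differentiate the coefficients of B along A and JA, s and t those of A along B and JB.
   Since J sends [P (He i)] to [- P (e i)], each of the four sums occurs twice with opposite signs
   in 4N. *)
pose p j := 'd (frame_coef B j \o cinv a) (chart a a) (orbit_lift e (frame_coef A) a).
pose q j := 'd (frame_coef B j \o cinv a) (chart a a)
  (orbit_lift (fun i => H (e i)) (frame_coef A) a).
pose s i := 'd (frame_coef A i \o cinv a) (chart a a) (orbit_lift e (frame_coef B) a).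
pose t i := 'd (frame_coef A i \o cinv a) (chart a a)
  (orbit_lift (fun i => H (e i)) (frame_coef B) a).
pose P X := push act x X a.
have PH X : J y (P X) = P (H X) by exact: push_J.
have PHH X : P (H (H X)) = - P X by rewrite -!PH JP.2.
pose Q X Y := \sum_i \sum_j (frame_coef A i a * frame_coef B j a) *: P (lie G (X i) (Y j)).
pose He := fun i => H (e i).
have {b1} b1 : vbracket JA JB y = Q He He + \sum_j q j *: P (He j) - \sum_i t i *: P (He i).
  exact: b1.
have {b2} b2 : J y (vbracket JA B y) = J y (Q He e) + \sum_j q j *: P (He j)
    + \sum_i s i *: P (e i).
  have -> : vbracket JA B y = Q He e + \sum_j q j *: P (e j) - \sum_i s i *: P (He i).
    exact: b2.
  rewrite linearB linearD /=; congr (_ + _ + _).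
    by rewrite linear_sum; apply: eq_bigr => j _; rewrite linearZ /= PH.
  rewrite linear_sum -sumrN; apply: eq_bigr => i _.
  by rewrite linearZ /= PH PHH scalerN opprK.
have {b3} b3 : J y (vbracket A JB y) = J y (Q e He) - \sum_j p j *: P (e j)
    - \sum_i t i *: P (He i).
  have -> : vbracket A JB y = Q e He + \sum_j p j *: P (He j) - \sum_i t i *: P (e i).
    exact: b3.
  rewrite linearB linearD /=; congr (_ + _ - _).
    rewrite linear_sum -sumrN; apply: eq_bigr => j _.
    by rewrite linearZ /= PH PHH scalerN.
  by rewrite linear_sum; apply: eq_bigr => i _; rewrite linearZ /= PH.
have {b4} b4 : vbracket A B y = Q e e + \sum_j p j *: P (e j) - \sum_i s i *: P (e i).
  exact: b4.
have JQ X Y : J y (Q X Y) =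
    \sum_i \sum_j (frame_coef A i a * frame_coef B j a) *: P (H (lie G (X i) (Y j))).
  rewrite linear_sum; apply: eq_bigr => i _; rewrite linear_sum.
  by apply: eq_bigr => j _; rewrite linearZ /= PH.
have -> : \sum_i \sum_j (frame_coef A i a * frame_coef B j a) *:
    P (lie G (He i) (He j) - H (lie G (He i) (e j))
      - H (lie G (e i) (He j)) - lie G (e i) (e j)) =
   Q He He - J y (Q He e) - J y (Q e He) - Q e e.
  rewrite !JQ -!sumrB; apply: eq_bigr => i _; rewrite -!sumrB.
  apply: eq_bigr => j _; rewrite -!scalerBr; congr (_ *: _).
  have PB X Y : P (X - Y) = P X - P Y.
    by have := push_linear act x a (-1) Y X; rewrite !scaleN1r ![- _ + _]addrC.
  by rewrite !PB.
rewrite b1 b2 b3 b4.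
move: (Q _ _) (Q _ _) (J y _) (J y _) => q1 q2 q3 q4.
move: (\sum_j q j *: P (He j)) (\sum_i t i *: P (He i)) => z1 z2.
move: (\sum_i s i *: P (e i)) (\sum_j p j *: P (e j)) => z3 z4.
by apply/rowP => k; rewrite !mxE; ring.
Qed.

Let sigma X Y := w x (D X) (D Y).

(** By invariance, w is constant on pushed vectors, so the pullback of w(B, C) to G has only its
    coefficients to differentiate; at a those of B and C are Kronecker deltas. *)
Lemma vderiv_push A B C j k U : open U -> U y -> smooth_vfield U A ->
  smooth_vfield U B -> smooth_vfield U C ->
  (forall l, frame_coef B l a = (l == j)%:R) -> (forall l, frame_coef C l a = (l == k)%:R) ->
  vderiv A (fun z => w z (B z) (C z)) y =
  \sum_l 'd (frame_coef C l \o cinv a) (chart a a)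
      (orbit_lift e (frame_coef A) a) * sigma (e j) (e l)
  + \sum_l 'd (frame_coef B l \o cinv a) (chart a a)
      (orbit_lift e (frame_coef A) a) * sigma (e l) (e k).
Proof.
move=> oU Uy As Bs Cs Bj Ck'.
have yy : cdom y y by exact: cdom_center.
have dB := smooth_vfield_differentiable Uy Bs.
have dC := smooth_vfield_differentiable Uy Cs.
pose f z : R^o := w z (B z) (C z).
have df : is_diff (chart y y) (f \o cinv y) ('d (f \o cinv y) (chart y y)).
  have [ws _ _ _] := wP.
  by apply: (Ck_is_diff (ws U B C oU Bs Cs y 1%N)); exists y.
have d1 := is_diff_pull actP yy df.
have Ay : A y = tmap orb a (orbit_lift e (frame_coef A) a).
  exact: esym (orbit_lift_related actP (frame_coefE A) a).
rewrite /vderiv -/y Ay; apply: etrans (esym (is_diffE d1 (orbit_lift e (frame_coef A) a))) _.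
set h := orbit_lift e (frame_coef A) a.
have phiE : (f \o orb) \o cinv a = fun u => \sum_p (frame_coef B p \o cinv a) u *:
    \sum_q (frame_coef C q \o cinv a) u *: (sigma (e p) (e q) : R^o).
  apply/funext => u; rewrite /f /= !frame_coefE linear_sumlz; apply: eq_bigr => p _.
  rewrite linearZl_LR /=; congr (_ * _).
  rewrite linear_sumr; apply: eq_bigr => q _.
  by rewrite linearZr_LR /= push_w.
have T := is_diff_sum (fun p => is_diff_scale (is_diffI (frame_coef_differentiable p dB))
  (is_diff_sum (fun q => is_diff_scale (is_diffI (frame_coef_differentiable q dC))
    (is_diff_cst (sigma (e p) (e q) : R^o) (chart a a))))).
rewrite phiE; apply: etrans (is_diffE T h) _.
rewrite big_split /= chartK; last exact: cdom_center.
congr (_ + _).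
  rewrite (bigD1 j)//= Bj eqxx scale1r [X in _ + X]big1 ?addr0.
    by apply: eq_bigr => l _; rewrite scaler0 add0r.
  by move=> p /negPf pj; rewrite Bj pj scale0r.
apply: eq_bigr => l _; congr (_ * _).
rewrite (bigD1 k)//= Ck' eqxx scale1r [X in _ + X]big1 ?addr0//.
by move=> p /negPf pj; rewrite Ck' pj scale0r.
Qed.

Lemma w_vbracket A B i j Z U : open U -> U y -> smooth_vfield U A ->
  smooth_vfield U B ->
  (forall l, frame_coef A l a = (l == i)%:R) -> (forall l, frame_coef B l a = (l == j)%:R) ->
  w y (vbracket A B y) (push act x Z a) = sigma (lie G (e i) (e j)) Z
  + \sum_l 'd (frame_coef B l \o cinv a) (chart a a)
      (orbit_lift e (frame_coef A) a) * sigma (e l) Z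
  - \sum_l 'd (frame_coef A l \o cinv a) (chart a a)
      (orbit_lift e (frame_coef B) a) * sigma (e l) Z.
Proof.
move=> oU Uy As Bs Ai Bj.
have dA := smooth_vfield_differentiable Uy As.
have dB := smooth_vfield_differentiable Uy Bs.
have cA l := frame_coef_differentiable l dA; have cB l := frame_coef_differentiable l dB.
rewrite (bracket_lift actP cA cB (frame_coefE A) (frame_coefE B) dA dB).
rewrite linearBl linearDl; congr (_ + _ - _).
- rewrite linear_sumlz (bigD1 i)//= [X in _ + X]big1 ?addr0; last first.
    move=> p /negPf pi; rewrite linear_sumlz big1// => q _.
    by rewrite Ai pi mul0r scale0r linear0l.
  rewrite linear_sumlz (bigD1 j)//= [X in _ + X]big1 ?addr0; last first.
    by move=> q /negPf qj; rewrite Bj qj mulr0 scale0r linear0l.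
  by rewrite Ai Bj !eqxx mulr1 scale1r push_w.
- by rewrite linear_sumlz; apply: eq_bigr => l _; rewrite linearZl_LR /= push_w.
- by rewrite linear_sumlz; apply: eq_bigr => l _; rewrite linearZl_LR /= push_w.
Qed.

Lemma form_alternating z u v : w z u v = - w z v u.
Proof.
have [_ alt _ _] := wP; apply/eqP; rewrite -subr_eq0 opprK.
by have := alt z (u + v); rewrite linearDl !linearDr !alt add0r addr0 => ->.
Qed.

(** [push] of a basis vector is not a field on M, so closedness is tested on coordinate fields with
    the same values at y. Their coefficients are not constant, but each of the six derivative terms
    [Sg] appears once from a derivative of w and once from a bracket, and cancels. *)
Lemma closed_push i j k :
  sigma (lie G (e i) (e j)) (e k) + sigma (lie G (e j) (e k)) (e i)
  + sigma (lie G (e k) (e i)) (e j) = 0.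
Proof.
pose F p := coord_field y (push act x (e p) a).
have Fs p : smooth_vfield (cdom y) (F p) by exact: coord_field_smooth.
have Fy p : F p y = push act x (e p) a by exact: coord_field_center.
have Fc p l : frame_coef (F p) l a = (l == p)%:R.
  by rewrite /frame_coef -/y Fy push_w e_orth eq_sym.
have oU : open (cdom y) by exact: cdom_open.
have Uy : cdom y y by exact: cdom_center.
have [_ _ _ cl] := wP.
have := cl _ _ _ _ oU (Fs i) (Fs j) (Fs k) y Uy.
rewrite (vderiv_push oU Uy (Fs i) (Fs j) (Fs k) (Fc j) (Fc k)).
rewrite (vderiv_push oU Uy (Fs j) (Fs k) (Fs i) (Fc k) (Fc i)).
rewrite (vderiv_push oU Uy (Fs k) (Fs i) (Fs j) (Fc i) (Fc j)).
rewrite !Fy.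
rewrite (w_vbracket _ oU Uy (Fs i) (Fs j) (Fc i) (Fc j)).
rewrite (w_vbracket _ oU Uy (Fs j) (Fs k) (Fc j) (Fc k)).
rewrite (w_vbracket _ oU Uy (Fs k) (Fs i) (Fc k) (Fc i)).
pose Sg p q Z := \sum_l 'd (frame_coef (F q) l \o cinv a) (chart a a)
  (orbit_lift e (frame_coef (F p)) a) * sigma (e l) Z.
have sw p q s : \sum_l 'd (frame_coef (F q) l \o cinv a) (chart a a)
  (orbit_lift e (frame_coef (F p)) a) * sigma (e s) (e l) = - Sg p q (e s).
  rewrite /Sg -sumrN; apply: eq_bigr => l _.
  by rewrite -mulrN; congr (_ * _); exact: form_alternating.
rewrite !sw -!/(Sg _ _ _).
have alg (a1 a2 a3 a4 a5 a6 s1 s2 s3 : R) :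
    - a1 + a2 + (- a3 + a4) + (- a5 + a6) - (s1 + a2 - a3) - (s2 + a4 - a5)
    - (s3 + a6 - a1) = 0 -> s1 + s2 + s3 = 0 by lra.
exact: alg.
Qed.

End Homogeneous.

(** * Algebra of the structure constants *)

Section TensorAlgebra.
Context {R : realFieldType} {V : lmodType R} {d : nat}.
Variables (e : 'I_d -> V) (H : V -> V) (h : 'I_d -> 'I_d -> R).
Hypothesis H_lin : linear H.
Hypothesis HE : forall i, H (e i) = \sum_l h i l *: e l.
Hypothesis h_anti : forall i l, h i l = - h l i.
Hypothesis HHE : forall i, H (H (e i)) = - e i.

Let He i := H (e i).

Lemma scalar_sum (F : V -> R) (I : finType) (c : I -> R) (u : I -> V) :
  scalar F -> F (\sum_i c i *: u i) = \sum_i c i * F (u i).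
Proof.
move=> Fl; pose FM := GRing.isLinear.Build _ _ _ _ _ Fl.
pose FL : {scalar V} := HB.pack F FM.
by rewrite -[F]/(FL : V -> R) linear_sum; apply: eq_bigr => i _; rewrite linearZ.
Qed.

Lemma scalarN (F : V -> R) u : scalar F -> F (- u) = - F u.
Proof.
move=> Fl; pose FM := GRing.isLinear.Build _ _ _ _ _ Fl.
pose FL : {scalar V} := HB.pack F FM.
by rewrite -[F]/(FL : V -> R) linearN.
Qed.

Lemma scalar_compH (F : V -> R) : scalar F -> scalar (F \o H).
Proof. by move=> Fl k u v; rewrite /= H_lin Fl. Qed.

(** H has an antisymmetric matrix in the basis e, so inside a contraction it moves to the other slot
    with a change of sign. *)
Lemma flip (b : V -> V -> R) : (forall v, scalar (b^~ v)) -> (forall u, scalar (b u)) ->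
  \sum_i b (He i) (e i) = - \sum_i b (e i) (He i).
Proof.
move=> bl br.
transitivity (\sum_i \sum_l h i l * b (e l) (e i)).
  by apply: eq_bigr => i _; rewrite /He HE (scalar_sum _ _ (bl (e i))).
rewrite exchange_big -sumrN /=; apply: eq_bigr => i _.
rewrite /He HE (scalar_sum _ _ (br (e i))) -sumrN; apply: eq_bigr => l _.
by rewrite h_anti mulNr.
Qed.

Lemma flip_same (b : V -> V -> R) :
  (forall v, scalar (b^~ v)) -> (forall u, scalar (b u)) ->
  \sum_i b (He i) (He i) = \sum_i b (e i) (e i).
Proof.
move=> bl br; rewrite (flip (b := fun u v => b u (H v))) -?sumrN.
- by apply: eq_bigr => i _; rewrite /He HHE scalarN ?opprK.
- by move=> v; exact: bl.
- by move=> u; exact: scalar_compH.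
Qed.

Lemma scalarMl (F : V -> R) c : scalar F -> scalar (fun u => F u * c).
Proof. by move=> Fl k u v; rewrite Fl mulrDl mulrA. Qed.

Lemma scalarMr (F : V -> R) c : scalar F -> scalar (fun u => c * F u).
Proof. by move=> Fl k u v; rewrite Fl mulrDr mulrCA. Qed.

Let S (f : 'I_d -> 'I_d -> 'I_d -> R) := \sum_i \sum_j \sum_k f i j k.

Let SE f g : (forall i j k, f i j k = g i j k) -> S f = S g.
Proof. by move=> fg; do 3!apply: eq_bigr => ? _; exact: fg. Qed.

Let SD f g : S (fun i j k => f i j k + g i j k) = S f + S g.
Proof. by rewrite /S -big_split; apply: eq_bigr => i _; rewrite -big_split;
  apply: eq_bigr => j _; rewrite -big_split. Qed.

Let SN f : S (fun i j k => - f i j k) = - S f.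
Proof. by rewrite /S -sumrN; apply: eq_bigr => i _; rewrite -sumrN;
  apply: eq_bigr => j _; rewrite -sumrN. Qed.

Let S12 f : S (fun i j k => f j i k) = S f.
Proof. by rewrite /S exchange_big. Qed.

Let S23 f : S (fun i j k => f i k j) = S f.
Proof. by apply: eq_bigr => i _; rewrite exchange_big. Qed.

(** The lemmas [flip3], [same3] and their variants ending in 2 and 1 apply [flip] and [flip_same] to
    the index in that position of a triple sum, the other two indices being fixed. *)
Let flip3 (F G : 'I_d -> 'I_d -> V -> R) :
  (forall i j, scalar (F i j)) -> (forall i j, scalar (G i j)) ->
  S (fun i j k => F i j (He k) * G i j (e k)) =
  - S (fun i j k => F i j (e k) * G i j (He k)).
Proof.
move=> Fl Gl; rewrite -SN /S; do 2!apply: eq_bigr => ? _; rewrite sumrN.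
by rewrite (flip (b := fun u v => F _ _ u * G _ _ v))// => ?;
  [exact: scalarMl|exact: scalarMr].
Qed.

Let same3 (F G : 'I_d -> 'I_d -> V -> R) :
  (forall i j, scalar (F i j)) -> (forall i j, scalar (G i j)) ->
  S (fun i j k => F i j (He k) * G i j (He k)) =
  S (fun i j k => F i j (e k) * G i j (e k)).
Proof.
move=> Fl Gl; do 2!apply: eq_bigr => ? _.
by rewrite (flip_same (b := fun u v => F _ _ u * G _ _ v))// => ?;
  [exact: scalarMl|exact: scalarMr].
Qed.

Let flip2 (F G : 'I_d -> V -> 'I_d -> R) :
  (forall i j, scalar (fun u => F i u j)) -> (forall i j, scalar (fun u => G i u j)) ->
  S (fun i j k => F i (He j) k * G i (e j) k) =
  - S (fun i j k => F i (e j) k * G i (He j) k).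
Proof.
move=> Fl Gl; rewrite -[LHS]S23 -[X in _ = - X]S23.
exact: (flip3 (F := fun i j u => F i u j) (G := fun i j u => G i u j)).
Qed.

Let same2 (F G : 'I_d -> V -> 'I_d -> R) :
  (forall i j, scalar (fun u => F i u j)) -> (forall i j, scalar (fun u => G i u j)) ->
  S (fun i j k => F i (He j) k * G i (He j) k) =
  S (fun i j k => F i (e j) k * G i (e j) k).
Proof.
move=> Fl Gl; rewrite -[LHS]S23 -[RHS]S23.
exact: (same3 (F := fun i j u => F i u j) (G := fun i j u => G i u j)).
Qed.

Let flip1 (F G : V -> 'I_d -> 'I_d -> R) :
  (forall i j, scalar (fun u => F u i j)) -> (forall i j, scalar (fun u => G u i j)) ->
  S (fun i j k => F (He i) j k * G (e i) j k) =
  - S (fun i j k => F (e i) j k * G (He i) j k).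
Proof.
move=> Fl Gl; rewrite -[LHS]S12 -[X in _ = - X]S12.
exact: (flip2 (F := fun i u j => F u i j) (G := fun i u j => G u i j)).
Qed.

Let same1 (F G : V -> 'I_d -> 'I_d -> R) :
  (forall i j, scalar (fun u => F u i j)) -> (forall i j, scalar (fun u => G u i j)) ->
  S (fun i j k => F (He i) j k * G (He i) j k) =
  S (fun i j k => F (e i) j k * G (e i) j k).
Proof.
move=> Fl Gl; rewrite -[LHS]S12 -[RHS]S12.
exact: (same2 (F := fun i u j => F u i j) (G := fun i u j => G u i j)).
Qed.

(* T X Y Z stands for <[X, Y]_m, Z>, and T_cyc for the closedness of the
   symplectic form, as sigma(X, Z) = - <X, HZ>. *)
Variable T : V -> V -> V -> R.
Hypothesis T1 : forall v z, scalar (fun u => T u v z).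
Hypothesis T2 : forall u z, scalar (fun v => T u v z).
Hypothesis T3 : forall u v, scalar (T u v).
Hypothesis T_anti : forall u v z, T u v z = - T v u z.
Hypothesis T_cyc : forall i j k,
  T (e i) (e j) (He k) + T (e j) (e k) (He i) + T (e k) (e i) (He j) = 0.

(** The cyclic identity is linear in its third vector, so it may be used at [He k]; H(He_k) = -e_k
    then frees the first term of H. *)
Let T_cycH i j k :
  T (e i) (e j) (e k) = T (e j) (He k) (He i) + T (He k) (e i) (He j).
Proof.
pose f u := T (e i) (e j) (H u) + T (e j) u (He i) + T u (e i) (He j).
have fl : scalar f.
  by move=> c u v; rewrite /f H_lin T3 T2 T1 /=; ring.
have : f (He k) = 0.
  rewrite /He HE (scalar_sum _ _ fl) big1// => l _.
  by rewrite /f T_cyc mulr0.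
rewrite /f {1}/He HHE scalarN// => /eqP; rewrite -addrA addrC subr_eq0 => /eqP ->.
by [].
Qed.

(** A, C and Y are the contractions that survive in the result; X1 and Q are the mixed products of
    the expanded square, which closedness reduces to C and Y. *)
Let A := S (fun i j k => T (e i) (e j) (e k) ^+ 2).
Let C := S (fun i j k => T (e i) (e j) (e k) * T (e i) (e k) (e j)).
Let Y := S (fun i j k => T (He i) (e j) (e k) * T (e i) (e k) (He j)).
Let X1 := S (fun i j k => T (e i) (e j) (He k) * T (e i) (He j) (e k)).
Let Q := S (fun i j k => T (He i) (He j) (e k) * T (e i) (e j) (e k)).

(** Closedness replaces the factor T(e_i, e_j, He_k) by two terms: the first gives Y after
    relabelling, and in the second both factors carry [He j], which [same2] removes to leave C. *)
Let X1E : X1 = Y + C.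
Proof.
transitivity (S (fun i j k => - (T (e j) (e k) (He i) * T (e i) (He j) (e k)) +
    - (T (e k) (e i) (He j) * T (e i) (He j) (e k)))).
  apply: SE => i j k; have := T_cyc i j k => /eqP; rewrite -addrA addr_eq0 => /eqP ->.
  by ring.
rewrite SD; congr (_ + _).
  rewrite -S12 /Y; apply: SE => i j k.
  by rewrite [T (e j) _ _]T_anti; ring.
transitivity (S (fun i j k => T (e i) (e k) (He j) * T (e i) (He j) (e k))).
  by apply: SE => i j k; rewrite [T (e k) _ _]T_anti; ring.
rewrite (same2 (F := fun i u k => T (e i) (e k) u) (G := fun i u k => T (e i) u (e k)))//.
Qed.

(** [T_cycH] splits the factor free of H into two terms, exchanged by swapping i and j and the
    antisymmetry of T; each contributes -Y. *)
Let QE : Q = - (2 * Y).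
Proof.
have Q1 : S (fun i j k => T (He i) (He j) (e k) * T (e j) (He k) (He i)) = - Y.
  rewrite (same1 (F := fun u j k => T u (He j) (e k))
    (G := fun u j k => T (e j) (He k) u))//.
  transitivity (S (fun i j k => T (e k) (He i) (e j) * T (e i) (He j) (e k))).
    by rewrite -S12 -S23; apply: SE => i j k; ring.
  transitivity (S (fun i j k => - (T (e i) (He j) (e k) * T (He i) (e k) (e j)))).
    by apply: SE => i j k; rewrite [T (e k) _ _]T_anti; ring.
  rewrite SN (flip2 (F := fun i u k => T (e i) u (e k))
    (G := fun i u k => T (He i) (e k) u))// opprK.
  transitivity (S (fun i j k => T (He i) (e k) (He j) * T (e i) (e j) (e k))).
    by apply: SE => i j k; rewrite mulrC.
  rewrite (flip1 (F := fun u j k => T u (e k) (He j)) (G := fun u j k => T u (e j) (e k)))//.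
  by congr (- _); apply: SE => i j k; rewrite mulrC.
transitivity (S (fun i j k => T (He i) (He j) (e k) * T (e j) (He k) (He i) +
    T (He i) (He j) (e k) * T (He k) (e i) (He j))).
  by apply: SE => i j k; rewrite T_cycH mulrDr.
rewrite SD Q1.
have -> : S (fun i j k => T (He i) (He j) (e k) * T (He k) (e i) (He j)) = - Y.
  rewrite -Q1 -S12; apply: SE => i j k.
  by rewrite [T (He j) _ _]T_anti [T (He k) _ _]T_anti; ring.
ring.
Qed.

(** The summand is the square of the e_k-component of 4N(e_i, e_j); its two terms with [H (e k)]
    have a plus sign because -<Hu, e_k> = <u, He_k>. On expansion the four squares give A each and
    the cross products give 8 X1 - 4 Q = 8 C + 16 Y. *)
Lemma nijenhuis_sum :
  \sum_i \sum_j \sum_k (T (H (e i)) (H (e j)) (e k) + T (H (e i)) (e j) (H (e k))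
    + T (e i) (H (e j)) (H (e k)) - T (e i) (e j) (e k)) ^+ 2 =
  4 * \sum_i \sum_j \sum_k T (e i) (e j) (e k) ^+ 2
  + 8 * \sum_i \sum_j \sum_k T (e i) (e j) (e k) * T (e i) (e k) (e j)
  + 16 * \sum_i \sum_j \sum_k T (H (e i)) (e j) (e k) * T (e i) (e k) (H (e j)).
Proof.
have t12 : S (fun i j k => T (He i) (He j) (e k) * T (He i) (He j) (e k)) = A.
  rewrite (same1 (F := fun u j k => T u (He j) (e k)) (G := fun u j k => T u (He j) (e k)))//.
  rewrite (same2 (F := fun i u k => T (e i) u (e k)) (G := fun i u k => T (e i) u (e k)))//.
have t13 : S (fun i j k => T (He i) (e j) (He k) * T (He i) (e j) (He k)) = A.
  rewrite (same1 (F := fun u j k => T u (e j) (He k)) (G := fun u j k => T u (e j) (He k)))//.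
  rewrite (same3 (F := fun i j u => T (e i) (e j) u) (G := fun i j u => T (e i) (e j) u))//.
have t23 : S (fun i j k => T (e i) (He j) (He k) * T (e i) (He j) (He k)) = A.
  rewrite (same2 (F := fun i u k => T (e i) u (He k)) (G := fun i u k => T (e i) u (He k)))//.
  rewrite (same3 (F := fun i j u => T (e i) (e j) u) (G := fun i j u => T (e i) (e j) u))//.
have c1 : S (fun i j k => T (He i) (He j) (e k) * T (He i) (e j) (He k)) = X1.
  rewrite (same1 (F := fun u j k => T u (He j) (e k)) (G := fun u j k => T u (e j) (He k)))//.
  by apply: SE => i j k; rewrite mulrC.
have c2 : S (fun i j k => T (He i) (He j) (e k) * T (e i) (He j) (He k)) = X1.
  rewrite (same2 (F := fun i u k => T (He i) u (e k)) (G := fun i u k => T (e i) u (He k)))//.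
  rewrite -S12; apply: SE => i j k.
  by rewrite [T (He j) _ _]T_anti [T (e j) _ _]T_anti; ring.
have c3 : S (fun i j k => T (He i) (e j) (He k) * T (e i) (He j) (He k)) = - Q.
  rewrite (same3 (F := fun i j u => T (He i) (e j) u) (G := fun i j u => T (e i) (He j) u))//.
  transitivity (S (fun i j k => T (e i) (He j) (e k) * T (He i) (e j) (e k))).
    by apply: SE => i j k; rewrite mulrC.
  rewrite (flip2 (F := fun i u k => T (e i) u (e k)) (G := fun i u k => T (He i) u (e k)))//.
  by congr (- _); apply: SE => i j k; rewrite mulrC.
have c4 : S (fun i j k => T (He i) (e j) (He k) * T (e i) (e j) (e k)) = - X1.
  rewrite (flip3 (F := fun i j u => T (He i) (e j) u) (G := fun i j u => T (e i) (e j) u))//.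
  congr (- _); rewrite -S12; apply: SE => i j k.
  by rewrite [T (He j) _ _]T_anti [T (e j) _ _]T_anti; ring.
have c5 : S (fun i j k => T (e i) (He j) (He k) * T (e i) (e j) (e k)) = - X1.
  rewrite (flip3 (F := fun i j u => T (e i) (He j) u) (G := fun i j u => T (e i) (e j) u))//.
  by congr (- _); apply: SE => i j k; rewrite mulrC.
have SZ c f : S (fun i j k => c * f i j k) = c * S f.
  by rewrite /S mulr_sumr; apply: eq_bigr => i _; rewrite mulr_sumr;
    apply: eq_bigr => j _; rewrite mulr_sumr.
transitivity (S (fun i j k =>
   T (He i) (He j) (e k) * T (He i) (He j) (e k)
   + (T (He i) (e j) (He k) * T (He i) (e j) (He k)
   + (T (e i) (He j) (He k) * T (e i) (He j) (He k)
   + (T (e i) (e j) (e k) ^+ 2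
   + (2 * (T (He i) (He j) (e k) * T (He i) (e j) (He k))
   + (2 * (T (He i) (He j) (e k) * T (e i) (He j) (He k))
   + (2 * (T (He i) (e j) (He k) * T (e i) (He j) (He k))
   + (- 2 * (T (He i) (He j) (e k) * T (e i) (e j) (e k))
   + (- 2 * (T (He i) (e j) (He k) * T (e i) (e j) (e k))
   + - 2 * (T (e i) (He j) (He k) * T (e i) (e j) (e k)))))))))))).
  by apply: SE => i j k; rewrite -!/(He _); ring.
rewrite !SD !SZ t12 t13 t23 c1 c2 c3 c4 c5 -/A -/Q QE X1E.
rewrite -[RHS]/(4 * A + 8 * C + 16 * Y); move: A C Y => sA sC sY; ring.
Qed.

End TensorAlgebra.

(** * Traces and Frobenius norms *)

Section Traces.
Context {R : realType} {r : nat}.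
Implicit Types (F K : 'rV[R]_r -> 'rV[R]_r).

Lemma endo_traceE F : endo_trace F = \sum_i F (delta_mx ord0 i) ord0 i.
Proof. by rewrite /endo_trace /mxtrace; apply: eq_bigr => i _; rewrite mxE. Qed.

Lemma endo_traceD F K : endo_trace (fun Z => F Z + K Z) = endo_trace F + endo_trace K.
Proof. by rewrite !endo_traceE -big_split; apply: eq_bigr => i _; rewrite mxE. Qed.

(** Endomorphisms of g that factor through the projection onto m have this form, so their traces are
    computed in a basis of m without choosing one of k. *)
Lemma endo_trace_rank1 (I : finType) (p : I -> 'rV[R]_r -> R) (v : I -> 'rV[R]_r) :
  (forall i, scalar (p i)) ->
  endo_trace (fun Z => \sum_i p i Z *: v i) = \sum_i p i (v i).
Proof.
move=> pl; rewrite endo_traceE.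
transitivity (\sum_i \sum_(j : I) p j (delta_mx ord0 i) * v j ord0 i).
  by apply: eq_bigr => i _; rewrite summxE; apply: eq_bigr => j _; rewrite mxE.
rewrite exchange_big; apply: eq_bigr => j _ /=.
rewrite [in RHS](row_sum_delta (v j)) (scalar_sum _ _ (pl j)).
by apply: eq_bigr => i _; rewrite mulrC.
Qed.

Lemma endo_traceC F K : linear F -> linear K ->
  endo_trace (F \o K) = endo_trace (K \o F).
Proof.
have main (F1 K1 : 'rV[R]_r -> 'rV[R]_r) : linear F1 -> endo_trace (F1 \o K1) =
    \sum_i \sum_l K1 (delta_mx ord0 i) ord0 l * F1 (delta_mx ord0 l) ord0 i.
  move=> Fl; pose FM := GRing.isLinear.Build _ _ _ _ _ Fl.
  pose FL : {linear 'rV[R]_r -> 'rV[R]_r} := HB.pack F1 FM.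
  rewrite endo_traceE; apply: eq_bigr => i _ /=.
  rewrite -[F1]/(FL : _ -> _) linear_rVE summxE; apply: eq_bigr => l _.
  by rewrite mxE.
move=> Fl Kl; rewrite !main// exchange_big; apply: eq_bigr => l _ /=.
by apply: eq_bigr => i _; rewrite mulrC.
Qed.

End Traces.

Section Frobenius.
Context {R : realType} {d : nat}.

Lemma sum_sqr_trace (A : 'M[R]_d) : \sum_i \sum_j A i j ^+ 2 = \tr (A *m A^T).
Proof.
rewrite /mxtrace; apply: eq_bigr => i _; rewrite mxE; apply: eq_bigr => j _.
by rewrite mxE expr2.
Qed.

(** The coefficients form an orthogonal matrix C and N becomes C N C^T, with the same Frobenius
    norm. Applied to each component of the Nijenhuis tensor, it allows the frame to be replaced by
    the pushed basis. *)
Lemma sum_sqr_orthogonal (c : 'I_d -> 'I_d -> R) (N : 'I_d -> 'I_d -> R) :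
  (forall i j, \sum_p c i p * c j p = (i == j)%:R) ->
  \sum_i \sum_j (\sum_p \sum_q c i p * c j q * N p q) ^+ 2 = \sum_p \sum_q N p q ^+ 2.
Proof.
move=> cc; pose C : 'M[R]_d := \matrix_(i, p) c i p.
pose Nm : 'M[R]_d := \matrix_(p, q) N p q.
have CC : C *m C^T = 1%:M.
  apply/matrixP => i j; rewrite !mxE -cc; apply: eq_bigr => p _; by rewrite !mxE.
have CC' := mulmx1C CC.
transitivity (\sum_i \sum_j (C *m Nm *m C^T) i j ^+ 2).
  apply: eq_bigr => i _; apply: eq_bigr => j _; congr (_ ^+ 2).
  rewrite mxE exchange_big /=; apply: eq_bigr => q _; rewrite !mxE mulr_suml.
  by apply: eq_bigr => p _; rewrite !mxE; ring.
rewrite sum_sqr_trace !trmx_mul trmxK.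
transitivity (\tr (Nm *m Nm^T)).
  have -> : C *m Nm *m C^T *m (C *m (Nm^T *m C^T)) =
      C *m (Nm *m (C^T *m C) *m Nm^T *m C^T) by rewrite !mulmxA.
  by rewrite CC' mulmx1 mxtrace_mulC -!mulmxA CC' mulmx1.
rewrite -sum_sqr_trace; apply: eq_bigr => i _; apply: eq_bigr => j _; by rewrite !mxE.
Qed.

Lemma sum_ltn_half (f : 'I_d -> 'I_d -> R) :
  (forall i j, f i j = f j i) -> (forall i, f i i = 0) ->
  \sum_(i < d) \sum_(j < d | (i < j)%N) f i j = 2^-1 * \sum_i \sum_j f i j.
Proof.
move=> fC f0.
have E : \sum_i \sum_j f i j = \sum_(i < d) \sum_(j < d | (i < j)%N) f i j +
    \sum_(i < d) \sum_(j < d | (j < i)%N) f i j.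
  rewrite -big_split; apply: eq_bigr => i _.
  rewrite (bigID (fun j : 'I_d => (i < j)%N)) /=; congr (_ + _).
  rewrite (bigD1 i) ?ltnn//= f0 add0r; apply: eq_bigl => j.
  by rewrite -leqNgt ltn_neqAle andbC.
have E2 : \sum_(i < d) \sum_(j < d | (j < i)%N) f i j = \sum_(i < d) \sum_(j < d | (i < j)%N) f i j.
  rewrite (exchange_big_dep predT)//=; apply: eq_bigr => i _.
  by apply: eq_bigr => j _; exact: fC.
rewrite E E2; lra.
Qed.

End Frobenius.

(** * The splitting of g and the norm formula *)

Section Reductive.
Context {R : realType} {d r : nat} {M : manifold R d} {G : lieGroup R r}.
Variables (w : two_form M) (J : endo_field M).
Hypotheses (wP : symplectic w) (JP : almost_complex J) (wJ : compatible w J).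
Variables (ex : 'rV[R]_r -> G) (act : G -> M -> M).
Hypotheses (exP : is_exponential ex) (actP : smooth_action act)
  (act_w : preserves_form act w) (act_J : preserves_endo act J).
Variables (x : M) (k m : {vspace 'rV[R]_r}).
Hypotheses
  (k_lie : forall X, X \in k <-> forall t : R, isotropy act x (ex (t *: X)))
  (km_sum : (k + m)%VS = fullv) (km_direct : (k :&: m)%VS = 0%VS)
  (m_Ad : forall a X, isotropy act x a -> X \in m -> Ad a X \in m).
Variable H : {linear 'rV[R]_r -> 'rV[R]_r}.
Hypotheses (H_k : forall X, X \in k -> H X = 0)
  (H_m : forall X, X \in m -> H X \in m)
  (H_J : forall X, X \in m ->
    fundamental_field act ex (H X) x = J x (fundamental_field act ex X x)).
Variable e : d.-tuple 'rV[R]_r.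
Hypotheses (e_basis : basis_of m e)
  (e_orthonormal : forall i j : 'I_d,
    pullback_form act ex w x (tnth e i) (H (tnth e j)) = (i == j)%:R).

Let D := tmap (act^~ x) (lone G).
Let ee i := tnth e i.

Let pullbackE X Y : pullback_form act ex w x X Y = w x (D X) (D Y).
Proof. by rewrite /pullback_form !(fundamental_fieldE exP actP). Qed.

Let wC u v : w x u v = - w x v u := form_alternating wP x u v.

Let D_k X : X \in k -> D X = 0.
Proof.
move=> /k_lie Xk; rewrite -[LHS](fundamental_fieldE exP actP X x) /fundamental_field.
have -> : (fun t : R^o => chart x (act (ex (t *: X)) x)) = cst (chart x x).
  by apply/funext => t; rewrite (Xk t).
exact: derive_cst.
Qed.

Let kmP X : exists Xk Xm, [/\ Xk \in k, Xm \in m & X = Xk + Xm].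
Proof.
have : X \in (k + m)%VS by rewrite km_sum memvf.
by case/memv_addP => Xk Xkk [Xm Xmm ->]; exists Xk, Xm.
Qed.

Let HJ X : J x (D X) = D (H X).
Proof.
have [Xk [Xm [Xkk Xmm ->]]] := kmP X.
rewrite [D (Xk + Xm)]linearD /= D_k// add0r linearD /= H_k// add0r.
by have := H_J Xmm; rewrite !(fundamental_fieldE exP actP).
Qed.

Let JJ u : J x (J x u) = - u. Proof. exact: JP.2. Qed.

Let wJJ u v : w x (J x u) (J x v) = w x u v. Proof. exact: wJ.1. Qed.

Let e_orth i j : w x (D (ee i)) (D (H (ee j))) = (i == j)%:R.
Proof. by rewrite -pullbackE e_orthonormal. Qed.

(** The scalar product of the m-components: [D] and [H] both kill k, so brackets can be inserted
    without projecting them first. *)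
Let ip X Y := w x (D X) (D (H Y)).

Let ip_scalarl Y : scalar (ip^~ Y).
Proof. by move=> c u v; rewrite /ip linearP linearPl. Qed.

Let ip_scalarr X : scalar (ip X).
Proof. by move=> c u v; rewrite /ip !linearP. Qed.

Let ipC X Y : ip X Y = ip Y X.
Proof. by rewrite /ip -!HJ -wJJ JJ linearNr wC opprK. Qed.

Let ipHr X Y : ip X (H Y) = - w x (D X) (D Y).
Proof. by rewrite /ip -!HJ JJ linearNr. Qed.

Let ipHl X Y : ip (H X) Y = w x (D X) (D Y).
Proof. by rewrite /ip -!HJ wJJ. Qed.

Let p j X := ip X (ee j).

Let p_scalar j : scalar (p j).
Proof. exact: ip_scalarl. Qed.

Let D_expand X : D X = \sum_j p j X *: D (ee j).
Proof. exact: gram_basis e_orth. Qed.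

Let ip_expand X Y : ip X Y = \sum_j p j X * p j Y.
Proof.
rewrite {1}/ip D_expand linear_sumlz; apply: eq_bigr => j _.
by rewrite linearZl_LR; congr (_ * _); exact: ipC.
Qed.

(** [proj] and [rest] are the projections onto m and k, written with the functionals [p j] so that
    [endo_trace_rank1] applies. *)
Let proj X := \sum_j p j X *: ee j.
Let rest X := X - proj X.

Let ee_m j : ee j \in m.
Proof. by rewrite -(span_basis e_basis) memv_span// mem_tnth. Qed.

Let p_ee i j : p j (ee i) = (i == j)%:R. Proof. exact: e_orth. Qed.

Let p_k j X : X \in k -> p j X = 0.
Proof. by move=> Xk; rewrite /p /ip D_k// linear0l. Qed.

Let m_expand X : X \in m -> X = proj X.
Proof.
move=> Xm; rewrite /proj.
have XE : X = \sum_i coord e i X *: ee i.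
  rewrite {1}(coord_basis e_basis Xm); apply: eq_bigr => i _.
  by rewrite /ee (tnth_nth 0).
rewrite {1}XE; apply: eq_bigr => j _; congr (_ *: _).
rewrite {2}XE (scalar_sum _ _ (p_scalar j)) (bigD1 j)//= p_ee eqxx mulr1.
by rewrite big1 ?addr0// => i /negPf ij; rewrite p_ee ij mulr0.
Qed.

Let projD X Y : proj (X + Y) = proj X + proj Y.
Proof.
rewrite /proj -big_split; apply: eq_bigr => j _ /=; rewrite -scalerDl; congr (_ *: _).
by have := p_scalar j 1 X Y; rewrite scale1r /= mul1r.
Qed.

Let rest_k X : rest X \in k.
Proof.
have [Xk [Xm [Xkk Xmm ->]]] := kmP X.
rewrite /rest projD [proj Xk]big1 ?add0r; last by move=> j _; rewrite p_k// scale0r.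
by rewrite -(m_expand Xmm) addrK.
Qed.

Let HHe j : H (H (ee j)) = - ee j.
Proof.
have HHm : H (H (ee j)) \in m by rewrite !H_m.
rewrite (m_expand HHm) [in RHS](m_expand (ee_m j)) /proj -sumrN.
apply: eq_bigr => i _; rewrite -scaleNr; congr (_ *: _).
by rewrite /p ipHl wC ipC.
Qed.

Let h i l := p l (H (ee i)).

Let HE i : H (ee i) = \sum_l h i l *: ee l.
Proof. by apply: m_expand; apply: H_m. Qed.

Let h_anti i l : h i l = - h l i.
Proof. by rewrite /h /p !ipHl wC. Qed.

Let H_linear : linear H. Proof. by move=> c u v; rewrite linearP. Qed.

Let T X Y Z := ip (lie G X Y) Z.

Let T1 Y Z : scalar (fun X => T X Y Z).
Proof. by move=> c u v; rewrite /T lie_linearl ip_scalarl. Qed.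

Let T2 X Z : scalar (fun Y => T X Y Z).
Proof. by move=> c u v; rewrite /T lie_linearr ip_scalarl. Qed.

Let T3 X Y : scalar (T X Y).
Proof. exact: ip_scalarr. Qed.

Let T_anti X Y Z : T X Y Z = - T Y X Z.
Proof. by rewrite /T lieC (scalarN _ (ip_scalarl Z)). Qed.

Let T_cyc i j l : T (ee i) (ee j) (H (ee l)) + T (ee j) (ee l) (H (ee i))
  + T (ee l) (ee i) (H (ee j)) = 0.
Proof.
rewrite /T !ipHr -!opprD; apply/eqP; rewrite oppr_eq0; apply/eqP.
exact: (closed_push wP actP act_w e_orth (lone G)).
Qed.

Let A := \sum_i \sum_j \sum_l T (ee i) (ee j) (ee l) ^+ 2.
Let C := \sum_i \sum_j \sum_l T (ee i) (ee j) (ee l) * T (ee i) (ee l) (ee j).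
Let Y0 := \sum_i \sum_j \sum_l
  T (H (ee i)) (ee j) (ee l) * T (ee i) (ee l) (H (ee j)).
Let K := \sum_i \sum_j p j (lie G (ee i) (rest (lie G (ee i) (ee j)))).

Let pi_sum X : daddv_pi k m X + daddv_pi m k X = X.
Proof. by apply: daddv_pi_add; rewrite ?km_sum ?memvf. Qed.

Let lie_km u Y : u \in k -> Y \in m -> lie G u Y \in m.
Proof.
move=> /k_lie uk Ym.
have mk : (m :&: k)%VS = 0%VS by rewrite capvC.
have q0 X : X \in m -> daddv_pi k m X = 0.
  move=> Xm; have := pi_sum X; rewrite (daddv_pi_id mk Xm) => /eqP.
  by rewrite -subr_eq0 addrK => /eqP.
have q : daddv_pi k m (lie G u Y) = 0.
  by apply: (linear_Ad_lie exP (w := 0)) => t; apply: q0; apply: m_Ad => //; exact: uk.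
by rewrite -(pi_sum (lie G u Y)) q add0r memv_pi.
Qed.

Let ip_pi X : ip (daddv_pi m k X) (daddv_pi m k X) = ip X X.
Proof.
have kk : daddv_pi k m X \in k by exact: memv_pi.
have DX : D X = D (daddv_pi m k X).
  by rewrite -{1}(pi_sum X) linearD /= D_k// add0r.
have HX : H X = H (daddv_pi m k X).
  by rewrite -{1}(pi_sum X) linearD /= H_k// add0r.
by rewrite /ip HX DX.
Qed.

Let lie_kH u X : u \in k -> D (lie G u (H X)) = J x (D (lie G u X)).
Proof.
move=> /k_lie uk.
pose JD : {linear 'rV[R]_r -> 'rV[R]_d} := J x \o D.
have d1 := is_diff_comp (Ad_diff exP u (H X)) (is_diff_linear D _).
have d2 := is_diff_comp (Ad_diff exP u X) (is_diff_linear JD _).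
have E : D \o (fun t : R^o => Ad (ex (t *: u)) (H X)) =
    JD \o (fun t : R^o => Ad (ex (t *: u)) X).
  apply/funext => t /=; have ax := uk t.
  have h1 := orbit_Ad actP (H X) ax; have h2 := orbit_Ad actP X ax.
  rewrite -/D in h1 h2; rewrite -h1 -h2 -HJ -act_J.
  by rewrite ax.
rewrite E in d1.
have := etrans (esym (is_diffE d1 (1 : R^o))) (is_diffE d2 (1 : R^o)).
by rewrite /= !scale1r.
Qed.


Let push_linearP a : linear ((push act x)^~ a) := push_linear act x a.

Let push_sum a (I : finType) (c : I -> R) (Z : I -> 'rV[R]_r) :
  \sum_i c i *: push act x (Z i) a = push act x (\sum_i c i *: Z i) a.
Proof.
pose PM := GRing.isLinear.Build _ _ _ _ _ (push_linearP a).
pose PL : {linear 'rV[R]_r -> 'rV[R]_d} := HB.pack ((push act x)^~ a) PM.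
rewrite -[RHS]/(PL _) linear_sum; apply: eq_bigr => i _.
by rewrite linearZ.
Qed.

Let metric_push a X Y : metric w J (act a x) (push act x X a) (push act x Y a) = ip X Y.
Proof. by rewrite /metric (push_J act_J HJ) (push_w act_w). Qed.

Let Nij i j := lie G (H (ee i)) (H (ee j)) - H (lie G (H (ee i)) (ee j))
  - H (lie G (ee i) (H (ee j))) - lie G (ee i) (ee j).

Let NijC i j : Nij i j = - Nij j i.
Proof.
rewrite /Nij (lieC G (H (ee j)) (H (ee i))) (lieC G (H (ee j)) (ee i)).
rewrite (lieC G (ee j) (H (ee i))) (lieC G (ee j) (ee i)) !linearN /=.
move: (lie G _ _) (H _) (H _) (lie G _ _) => a b c z.
by apply/rowP => l; rewrite !mxE; ring.
Qed.

Let p_Nij i j l : p l (Nij i j) = T (H (ee i)) (H (ee j)) (ee l)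
  + T (H (ee i)) (ee j) (H (ee l)) + T (ee i) (H (ee j)) (H (ee l))
  - T (ee i) (ee j) (ee l).
Proof.
have pB X Z : p l (X - Z) = p l X - p l Z.
  by have := p_scalar l (-1) Z X; rewrite scaleN1r mulN1r ![- _ + _]addrC.
have pH X : p l (H X) = - ip X (H (ee l)) by rewrite /p ipHl ipHr opprK.
by rewrite /Nij 3!pB !pH !opprK.
Qed.

(** The factor 1/32 is the square of the 1/4 in the Nijenhuis tensor times the 1/2 from restricting
    the sum to i < j. *)
Lemma nijenhuis_norm2E a U (eps : 'I_d -> M -> 'rV[R]_d) :
  open U -> U (act a x) -> local_orthonormal_frame w J U eps ->
  nijenhuis_norm2 w J eps (act a x) = 32^-1 * (4 * A + 8 * C + 16 * Y0).
Proof.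
move=> oU Uy [eps_s eps_o].
pose c i q : R := frame_coef w act x H ee (eps i) q a.
pose Z i j := 4^-1 *: \sum_q \sum_s (c i q * c j s) *: Nij q s.
have NE i j : nijenhuis J (eps i) (eps j) (act a x) = push act x (Z i j) a.
  rewrite (nijenhuis_push wP JP actP act_w act_J HJ e_orth oU Uy (eps_s i) (eps_s j)).
  have pZ b X : push act x (b *: X) a = b *: push act x X a.
    by have := push_linearP a b X 0; rewrite addr0 /push !linear0 addr0.
  rewrite /Z pZ; congr (_ *: _).
  have := push_sum a (fun _ : 'I_d => 1) (fun q => \sum_s (c i q * c j s) *: Nij q s).
  under [in RHS]eq_bigr => q _ do rewrite scale1r.
  move=> <-; apply: eq_bigr => q _; rewrite scale1r -push_sum.
  by apply: eq_bigr => s _.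
(* The matrix c is orthogonal, as it relates two orthonormal bases of the tangent space at
   [act a x]: the frame and the pushed basis. *)
have cc i j : \sum_q c i q * c j q = (i == j)%:R.
  have epsE i' : eps i' (act a x) = push act x (\sum_q c i' q *: ee q) a.
    by rewrite -push_sum; exact: (frame_coefE act_w e_orth).
  rewrite -(eps_o _ Uy i j) !epsE metric_push ip_expand.
  apply: eq_bigr => q _.
  have pc i' : p q (\sum_s c i' s *: ee s) = c i' q.
    rewrite (scalar_sum _ _ (p_scalar q)) (bigD1 q)//= p_ee eqxx mulr1.
    by rewrite big1 ?addr0// => s /negPf sq; rewrite p_ee sq mulr0.
  by rewrite !pc.
have pZ l i j : p l (Z i j) = 4^-1 * \sum_q \sum_s c i q * c j s * p l (Nij q s).
  have pZ' b X : p l (b *: X) = b * p l X.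
    by have := scalar_sum (fun _ : 'I_1 => b) (fun _ => X) (p_scalar l); rewrite !big_ord1.
  rewrite /Z pZ'; congr (_ * _).
  have := scalar_sum (fun _ : 'I_d => 1) (fun q => \sum_s (c i q * c j s) *: Nij q s) (p_scalar l).
  under eq_bigr => q _ do rewrite scale1r.
  move=> ->; apply: eq_bigr => q _; rewrite mul1r.
  exact: scalar_sum (p_scalar l).
pose f i j := ip (Z i j) (Z i j).
have ZC i j : Z i j = - Z j i.
  rewrite /Z -scalerN -sumrN exchange_big; congr (_ *: _); apply: eq_bigr => q _.
  rewrite -sumrN; apply: eq_bigr => s _.
  by rewrite (NijC s q) scalerN [c i s * _]mulrC.
have ipN X X' : ip (- X) (- X') = ip X X'.
  by rewrite (scalarN _ (ip_scalarl _)) (scalarN _ (ip_scalarr _)) opprK.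
have fC i j : f i j = f j i by rewrite /f ZC ipN.
have f0 i : f i i = 0.
  have : f i i = ip (Z i i) (- Z i i) by rewrite /f -(ZC i i).
  rewrite (scalarN _ (ip_scalarr _)) -/(f i i) => ff; lra.
transitivity (\sum_(i < d) \sum_(j < d | (i < j)%N) f i j).
  apply: eq_bigr => i _; apply: eq_bigr => j _.
  by rewrite /= NE metric_push.
rewrite (sum_ltn_half fC f0).
have -> : \sum_i \sum_j f i j =
    16^-1 * \sum_l \sum_q \sum_s p l (Nij q s) ^+ 2.
  transitivity (\sum_l \sum_i \sum_j p l (Z i j) ^+ 2).
    rewrite [RHS]exchange_big; apply: eq_bigr => i _.
    rewrite [RHS]exchange_big; apply: eq_bigr => j _.
    by rewrite /f ip_expand; apply: eq_bigr => l _; rewrite expr2.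
  rewrite mulr_sumr; apply: eq_bigr => l _.
  rewrite -(sum_sqr_orthogonal (fun q s => p l (Nij q s)) cc) mulr_sumr.
  apply: eq_bigr => i _; rewrite mulr_sumr; apply: eq_bigr => j _.
  by rewrite pZ exprMn; congr (_ * _); rewrite expr2 -invfM; congr (_^-1); ring.
have -> : \sum_l \sum_q \sum_s p l (Nij q s) ^+ 2 = 4 * A + 8 * C + 16 * Y0.
  rewrite -(nijenhuis_sum H_linear HE h_anti HHe T1 T2 T3 T_anti T_cyc).
  rewrite exchange_big; apply: eq_bigr => q _; rewrite exchange_big.
  by apply: eq_bigr => s _; apply: eq_bigr => l _; rewrite p_Nij.
by rewrite mulrA; congr (_ * _); rewrite -invfM; congr (_^-1); ring.
Qed.


Let projE X : X = proj X + rest X.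
Proof. by rewrite /rest addrC subrK. Qed.

Let proj_linear : linear proj.
Proof.
move=> c X Z; rewrite /proj scaler_sumr -big_split; apply: eq_bigr => j _ /=.
by rewrite p_scalar scalerDl scalerA.
Qed.

Let rest_linear : linear rest.
Proof.
move=> c X Z; rewrite /rest proj_linear; move: (proj X) (proj Z) => a b.
by rewrite scalerBr opprD addrACA.
Qed.

Let lieDr X Z Z' : lie G X (Z + Z') = lie G X Z + lie G X Z'.
Proof. by have := lie_linearr G X 1 Z Z'; rewrite !scale1r. Qed.

Let lie_proj X Z : lie G X (proj Z) = \sum_j p j Z *: lie G X (ee j).
Proof.
pose LM := GRing.isLinear.Build _ _ _ _ _ (lie_linearr G X).
pose L : {linear 'rV[R]_r -> 'rV[R]_r} := HB.pack (lie G X) LM.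
rewrite -[LHS]/(L _) linear_sum; apply: eq_bigr => j _.
by rewrite linearZ.
Qed.

Let p_lie_proj j X Z : p j (lie G X (proj Z)) = \sum_l p l Z * p j (lie G X (ee l)).
Proof. by rewrite lie_proj (scalar_sum _ _ (p_scalar j)). Qed.

Let pD j X Z : p j (X + Z) = p j X + p j Z.
Proof. by have := p_scalar j 1 X Z; rewrite scale1r /= mul1r. Qed.

(** On k the inner bracket lands in m, so this part of the square of a = ad_{e_i} is (a proj)(a
    rest). Cyclicity turns its trace into that of (a rest)(a proj), which factors through m. *)
Let trace_ad2 i : endo_trace (fun Z => lie G (ee i) (lie G (ee i) Z)) =
  \sum_j p j (lie G (ee i) (lie G (ee i) (ee j)))
  + \sum_j p j (lie G (ee i) (rest (lie G (ee i) (ee j)))).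
Proof.
pose a := lie G (ee i).
have al : linear a := lie_linearr G (ee i).
have aD X Z : a (X + Z) = a X + a Z by exact: lieDr.
have comp_linear (F1 F2 : 'rV[R]_r -> 'rV[R]_r) : linear F1 -> linear F2 -> linear (F1 \o F2).
  by move=> l1 l2 c u v; rewrite /= l2 l1.
have -> : endo_trace (fun Z => a (a Z)) = endo_trace (fun Z => \sum_j p j Z *: a (a (ee j)))
    + endo_trace ((a \o proj) \o (a \o rest)).
  rewrite -endo_traceD; congr endo_trace; apply/funext => Z.
  rewrite /= {1}(projE Z) (aD (proj Z)) (aD (a (proj Z))); congr (_ + _).
    rewrite /a lie_proj; pose LM := GRing.isLinear.Build _ _ _ _ _ al.
    pose L : {linear 'rV[R]_r -> 'rV[R]_r} := HB.pack a LM.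
    rewrite -[LHS]/(L _) linear_sum; apply: eq_bigr => j _.
    by rewrite linearZ.
  congr (a _); apply: m_expand; rewrite /a lieC memvN.
  by apply: lie_km.
rewrite (endo_trace_rank1 _ p_scalar); congr (_ + _).
rewrite endo_traceC; last 2 first.
- exact: comp_linear.
- exact: comp_linear.
have -> : (a \o rest) \o (a \o proj) = fun Z => \sum_j p j Z *: a (rest (a (ee j))).
  have lc : linear (a \o rest) by exact: comp_linear.
  pose LM := GRing.isLinear.Build _ _ _ _ _ lc.
  pose L : {linear 'rV[R]_r -> 'rV[R]_r} := HB.pack (a \o rest) LM.
  apply/funext => Z; rewrite /= [a (proj Z)]lie_proj -[LHS]/(L _) linear_sum.
  by apply: eq_bigr => j _; rewrite linearZ.
by rewrite (endo_trace_rank1 _ p_scalar).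
Qed.

Let sum_trace_ad2 :
  \sum_i endo_trace (fun Z => lie G (ee i) (lie G (ee i) Z)) = C + 2 * K.
Proof.
under eq_bigr => i _ do rewrite trace_ad2.
rewrite big_split /= -/K.
(* The m-component of the inner bracket gives C, its k-component a second copy of K. *)
have -> : \sum_i \sum_j p j (lie G (ee i) (lie G (ee i) (ee j))) = C + K.
  rewrite /C /K -big_split; apply: eq_bigr => i _; rewrite -big_split.
  apply: eq_bigr => j _ /=; rewrite [in LHS](projE (lie G (ee i) (ee j))) lieDr pD.
  by congr (_ + _); rewrite p_lie_proj.
ring.
Qed.

(** The image of H lies in m, so by cyclicity the action of ad_X on k does not contribute: [rest]
    vanishes on that image. *)
Let trace_H_ad X : endo_trace (fun Z => H (lie G X Z)) =
  - \sum_j ip (lie G X (ee j)) (H (ee j)).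
Proof.
pose a := lie G X; have al : linear a := lie_linearr G X.
have aD Z Z' : a (Z + Z') = a Z + a Z' by exact: lieDr.
have comp_linear (F1 F2 : 'rV[R]_r -> 'rV[R]_r) : linear F1 -> linear F2 -> linear (F1 \o F2).
  by move=> l1 l2 c u v; rewrite /= l2 l1.
have -> : endo_trace (fun Z => H (a Z)) = endo_trace (fun Z => \sum_j p j Z *: H (a (ee j)))
    + endo_trace (H \o (a \o rest)).
  rewrite -endo_traceD; congr endo_trace; apply/funext => Z.
  rewrite /= {1}(projE Z) (aD (proj Z)) linearD; congr (_ + _).
  by rewrite /a lie_proj linear_sum; apply: eq_bigr => j _; rewrite linearZ.
rewrite (endo_trace_rank1 _ p_scalar) endo_traceC; last 2 first.
- exact: H_linear.
- exact: comp_linear.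
have -> : (a \o rest) \o H = fun _ => 0.
  apply/funext => Z /=.
  have -> : rest (H Z) = 0.
    have HZ : H Z \in m.
      have [Xk [Xm [Xkk Xmm ->]]] := kmP Z.
      by rewrite linearD /= H_k// add0r H_m.
    by rewrite /rest -(m_expand HZ) subrr.
  by have := aD 0 0; rewrite addr0 -{1}[a 0]addr0 => /addrI <-.
have z : endo_trace (fun _ : 'rV[R]_r => 0 : 'rV[R]_r) = 0.
  by rewrite endo_traceE big1// => i _; rewrite mxE.
rewrite z addr0.
by rewrite -sumrN; apply: eq_bigr => j _; rewrite /p ipHl ipHr opprK.
Qed.

(* For u in k, <[v, u], H z> = - <[H v, u], z>. *)
Let K_twist : \sum_i \sum_j ip (lie G (ee i) (rest (lie G (H (ee i)) (ee j)))) (H (ee j)) = - K.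
Proof.
have step u v j : u \in k -> ip (lie G v u) (H (ee j)) = - p j (lie G (H v) u).
  move=> uk; rewrite ipHr /p !(lieC G _ u).
  have DN X : D (- X) = - D X by rewrite linearN.
  rewrite /ip !DN linearNl lie_kH// -HJ; congr (- _).
  by rewrite linearNl wJJ.
pose b u v := \sum_j p j (lie G u (rest (lie G v (ee j)))).
have bl v : scalar (b^~ v).
  move=> c u u'; rewrite /b mulr_sumr -big_split; apply: eq_bigr => j _ /=.
  by rewrite lie_linearl p_scalar.
have br u : scalar (b u).
  move=> c v v'; rewrite /b mulr_sumr -big_split; apply: eq_bigr => j _ /=.
  by rewrite lie_linearl rest_linear lie_linearr p_scalar.
(* The vectors He_i can replace the e_i in the contraction defining K; this matches the [H v]
   produced by [step]. *)
have -> : K = \sum_i b (H (ee i)) (H (ee i)).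
  exact: esym (flip_same H_linear HE h_anti HHe bl br).
rewrite -sumrN; apply: eq_bigr => i _; rewrite -sumrN; apply: eq_bigr => j _.
exact: step.
Qed.

(** The Jacobi identity splits the double bracket into two sums that are opposite by [flip], whence
    the factor 2. In the remaining sum the m-component of the inner bracket gives Y0, and the
    k-component gives -K by [K_twist]. *)
Let lie_lie_sum : \sum_i \sum_j ip (lie G (lie G (ee i) (H (ee i))) (ee j)) (H (ee j))
  = 2 * (Y0 - K).
Proof.
pose b u v := \sum_j ip (lie G u (lie G v (ee j))) (H (ee j)).
have bl v : scalar (b^~ v).
  move=> c u u'; rewrite /b mulr_sumr -big_split; apply: eq_bigr => j _ /=.
  by rewrite lie_linearl ip_scalarl.
have br u : scalar (b u).
  move=> c v v'; rewrite /b mulr_sumr -big_split; apply: eq_bigr => j _ /=.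
  by rewrite lie_linearl lie_linearr ip_scalarl.
have jac i j : lie G (lie G (ee i) (H (ee i))) (ee j) =
   lie G (ee i) (lie G (H (ee i)) (ee j)) - lie G (H (ee i)) (lie G (ee i) (ee j)).
  by rewrite (lie_jacobi exP (ee i)) addrK.
have ipB X X' Z : ip (X - X') Z = ip X Z - ip X' Z.
  by have := ip_scalarl Z (-1) X' X; rewrite scaleN1r /= mulN1r ![- _ + _]addrC.
have -> : \sum_i \sum_j ip (lie G (lie G (ee i) (H (ee i))) (ee j)) (H (ee j)) =
    \sum_i b (ee i) (H (ee i)) - \sum_i b (H (ee i)) (ee i).
  rewrite -sumrB; apply: eq_bigr => i _; rewrite -sumrB; apply: eq_bigr => j _.
  by rewrite jac ipB.
have F := flip HE h_anti bl br.
apply: etrans (congr1 (fun z => \sum_i b (ee i) (H (ee i)) - z) F) _.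
suff -> : \sum_i b (ee i) (H (ee i)) = Y0 - K by ring.
rewrite -K_twist /Y0 /b -big_split; apply: eq_bigr => i _; rewrite -big_split.
apply: eq_bigr => j _ /=; rewrite [in LHS](projE (lie G (H (ee i)) (ee j))) lieDr.
have ipD X X' Z : ip (X + X') Z = ip X Z + ip X' Z.
  by have := ip_scalarl Z 1 X X'; rewrite scale1r /= mul1r.
rewrite ipD; congr (_ + _); rewrite lie_proj (scalar_sum _ _ (ip_scalarl _)).
by [].
Qed.


Variables (n : nat) (fl fr : 'I_n -> 'rV[R]_r).
Hypotheses (fl_m : forall l, fl l \in m) (fr_m : forall l, fr l \in m).
Hypothesis f_expand : forall X, X \in m ->
  X = \sum_l (w x (D X) (D (fr l)) *: fl l - w x (D X) (D (fl l)) *: fr l).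

Let xi := \sum_l lie G (fl l) (fr l).

(** The families e_i and He_i are dual to each other for the symplectic form. *)
Let H_expand Z : Z \in m -> \sum_i w x (D (ee i)) (D Z) *: H (ee i) = Z.
Proof.
move=> Zm.
transitivity (- H (proj (H Z))).
  rewrite /proj linear_sum -sumrN; apply: eq_bigr => i _.
  by rewrite linearZ -scaleNr /p ipHl wC.
have HHZ : H (H Z) = - Z.
  rewrite {1}(m_expand Zm) /proj !linear_sum {2}(m_expand Zm) /proj -sumrN.
  by apply: eq_bigr => i _; rewrite !linearZ /= HHe scalerN.
by rewrite -(m_expand (H_m Zm)) HHZ opprK.
Qed.

Let lie_sumr (I : finType) X (c : I -> R) (Z : I -> 'rV[R]_r) :
  lie G X (\sum_i c i *: Z i) = \sum_i c i *: lie G X (Z i).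
Proof.
pose LM := GRing.isLinear.Build _ _ _ _ _ (lie_linearr G X).
pose L : {linear 'rV[R]_r -> 'rV[R]_r} := HB.pack (lie G X) LM.
rewrite -[LHS]/(L _) linear_sum; apply: eq_bigr => j _.
by rewrite linearZ.
Qed.

Let lie_suml (I : finType) X (c : I -> R) (Z : I -> 'rV[R]_r) :
  lie G (\sum_i c i *: Z i) X = \sum_i c i *: lie G (Z i) X.
Proof.
rewrite lieC lie_sumr -sumrN; apply: eq_bigr => i _.
by rewrite -scalerN -lieC.
Qed.

(** Both sides contract the bracket with the inverse of the symplectic form. Expanding e_i in the
    symplectic basis and summing over i by [H_expand], the half [fl] and the half [fr] give xi each,
    the latter after exchanging the two arguments. *)
Let xiE : \sum_i lie G (ee i) (H (ee i)) = xi + xi.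
Proof.
pose sg X Z := w x (D X) (D Z).
have e_expand i : ee i = \sum_l (sg (ee i) (fr l) *: fl l + (- sg (ee i) (fl l)) *: fr l).
  rewrite {1}(f_expand (ee_m i)); apply: eq_bigr => l _.
  by rewrite scaleNr.
transitivity (\sum_i (\sum_l sg (ee i) (fr l) *: lie G (fl l) (H (ee i)) +
    \sum_l (- sg (ee i) (fl l)) *: lie G (fr l) (H (ee i)))).
  apply: eq_bigr => i _; rewrite {1}(e_expand i) big_split /=.
  rewrite lieC; apply: etrans (congr1 -%R (lieDr _ _ _)) _.
  rewrite opprD -lieC -lieC; congr (_ + _); exact: lie_suml.
rewrite big_split /=; congr (_ + _).
  rewrite exchange_big; apply: eq_bigr => l _.
  by rewrite -lie_sumr; congr (lie G _ _); exact: H_expand.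
rewrite exchange_big; apply: eq_bigr => l _.
rewrite -lie_sumr.
have -> : \sum_i - sg (ee i) (fl l) *: H (ee i) = - fl l.
  rewrite -[in RHS](H_expand (fl_m l)) -sumrN.
  by apply: eq_bigr => i _; rewrite scaleNr.
have := lie_linearr G (fr l) (-1) (fl l) 0; rewrite !scaleN1r !addr0 => ->.
have z : lie G (fr l) 0 = 0.
  by have := lie_sumr (fr l) (fun i : 'I_0 => 0) (fun=> 0); rewrite !big_ord0.
by rewrite z addr0; exact: esym (lieC G _ _).
Qed.

Lemma nijenhuis_formula a U (eps : 'I_d -> M -> 'rV[R]_d) :
  open U -> U (act a x) -> local_orthonormal_frame w J U eps ->
  nijenhuis_norm2 w J eps (act a x) =
  8^-1 * (\sum_i \sum_j ip (daddv_pi m k (lie G (ee i) (ee j)))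
           (daddv_pi m k (lie G (ee i) (ee j))))
  + 4^-1 * (\sum_i endo_trace (fun Z => lie G (ee i) (lie G (ee i) Z)))
  - 2^-1 * endo_trace (fun Z => H (lie G xi Z)).
Proof.
move=> oU Uy fr_eps; rewrite (nijenhuis_norm2E oU Uy fr_eps) sum_trace_ad2 trace_H_ad.
have -> : \sum_i \sum_j ip (daddv_pi m k (lie G (ee i) (ee j)))
   (daddv_pi m k (lie G (ee i) (ee j))) = A.
  apply: eq_bigr => i _; apply: eq_bigr => j _; rewrite ip_pi ip_expand.
  by apply: eq_bigr => l _; rewrite expr2.
have xs : \sum_j ip (lie G xi (ee j)) (H (ee j)) = Y0 - K.
  have h2 : \sum_j ip (lie G (xi + xi) (ee j)) (H (ee j)) = 2 * (Y0 - K).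
    rewrite -xiE -lie_lie_sum exchange_big; apply: eq_bigr => j _ /=.
    have E : \sum_i lie G (ee i) (H (ee i)) = \sum_i 1 *: lie G (ee i) (H (ee i)).
      by apply: eq_bigr => i _; rewrite scale1r.
    rewrite E lie_suml (scalar_sum _ _ (ip_scalarl _)).
    by apply: eq_bigr => i _; rewrite mul1r.
  have h1 : \sum_j ip (lie G (xi + xi) (ee j)) (H (ee j)) =
      2 * \sum_j ip (lie G xi (ee j)) (H (ee j)).
    rewrite mulr_sumr; apply: eq_bigr => j _.
    have := lie_linearl G (ee j) 1 xi xi; rewrite !scale1r => ->.
    have := ip_scalarl (H (ee j)) 1 (lie G xi (ee j)) (lie G xi (ee j)).
    by rewrite scale1r /= mul1r => ->; rewrite mulr2n mulrDl mul1r.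
  apply: (@mulfI _ (2 : R)); first by rewrite pnatr_eq0.
  by rewrite -h1 h2.
(* What remains is A/8 + C/4 + Y0/2 = A/8 + (C + 2K)/4 + (Y0 - K)/2. *)
rewrite xs; move: A C Y0 K => sA sC sY sK; lra.
Qed.

End Reductive.

(** Pairing X with f_{l+n} reads off its coefficient on f_l, and pairing it with f_l reads off minus
    its coefficient on f_{l+n}. The relations are given for i < j only; antisymmetry and the
    vanishing of s on the diagonal supply the others. *)
Lemma symplectic_basis_expand (R : fieldType) (V : vectType R) n (m : {vspace V})
    (f : (n + n).-tuple V) (s : V -> V -> R) :
  (forall Y, scalar (s^~ Y)) -> (forall X Y, s X Y = - s Y X) -> (forall X, s X X = 0) ->
  basis_of m f ->
  (forall i j : 'I_(n + n), (i < j)%N ->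
    s (tnth f i) (tnth f j) = (val j == val i + n)%N%:R) ->
  forall X, X \in m -> X = \sum_(l < n) (s X (tnth f (rshift n l)) *: tnth f (lshift n l)
    - s X (tnth f (lshift n l)) *: tnth f (rshift n l)).
Proof.
move=> sl sC s0 fb fs X Xm.
have XE : X = \sum_i coord f i X *: tnth f i.
  rewrite {1}(coord_basis fb Xm); apply: eq_bigr => i _.
  by rewrite (tnth_nth 0).
pose c i := coord f i X.
have slE Y : s X Y = \sum_i c i * s (tnth f i) Y.
  rewrite {1}XE; pose sM := GRing.isLinear.Build _ _ _ _ _ (sl Y).
  pose sL : {scalar V} := HB.pack (s^~ Y) sM.
  rewrite -[LHS]/(sL _) linear_sum; apply: eq_bigr => i _.
  by rewrite linearZ.
have s_r (l : 'I_n) (i : 'I_(n + n)) :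
    s (tnth f i) (tnth f (rshift n l)) = (i == lshift n l)%:R.
  have [il|li|/val_inj ->] := ltngtP i (rshift n l).
  - by rewrite fs//= addnC eqn_add2r -val_eqE/= eq_sym.
  - rewrite sC fs// -val_eqE /=.
    have -> : (val i == n + l + n)%N = false.
      by apply/negbTE; rewrite neq_ltn (leq_trans (ltn_ord i))// addnAC leq_addr.
    have -> : (val i == l)%N = false.
      by apply/negbTE; rewrite neq_ltn orbC (leq_trans _ li)// ltnS leq_addl.
    by rewrite oppr0.
  - by rewrite s0 eq_sym eq_lrshift.
have s_l (l : 'I_n) (i : 'I_(n + n)) :
    s (tnth f i) (tnth f (lshift n l)) = - (i == rshift n l)%:R.
  have [il|li|/val_inj ->] := ltngtP i (lshift n l).
  - rewrite fs// -val_eqE /=.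
    have -> : (val l == i + n)%N = false.
      by apply/negbTE; rewrite neq_ltn (leq_trans (ltn_ord l))// leq_addl.
    have -> : (val i == n + l)%N = false.
      apply/negbTE; rewrite neq_ltn (leq_trans il)//=; exact: leq_addl.
    by rewrite oppr0.
  - by rewrite sC fs//= -val_eqE /= addnC.
  - by rewrite s0 eq_lrshift oppr0.
have cr l : s X (tnth f (rshift n l)) = c (lshift n l).
  rewrite slE (bigD1 (lshift n l))//= s_r eqxx mulr1 big1 ?addr0// => i /negPf il.
  by rewrite s_r il mulr0.
have cl l : s X (tnth f (lshift n l)) = - c (rshift n l).
  rewrite slE (bigD1 (rshift n l))//= s_l eqxx mulrN1 big1 ?addr0// => i /negPf il.
  by rewrite s_l il oppr0 mulr0.
rewrite {1}XE big_split_ord /= -big_split; apply: eq_bigr => l _ /=.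
by rewrite cr cl scaleNr opprK.
Qed.

Theorem proposition18 (R : realType) (n r : nat)
  (* the almost-Kaehler manifold (M, w, J) *)
  (M : manifold R (n + n)) (w : two_form M)
  (J : endo_field M)
  (M_connected : connected [set: M])
  (w_symplectic : symplectic w)
  (J_almost_complex : almost_complex J)
  (wJ_compatible : compatible w J)
  (* the Lie group G, its exponential map and its action on M *)
  (G : lieGroup R r) (ex : 'rV[R]_r -> G) (act : G -> M -> M)
  (G_connected : connected [set: G])
  (ex_exponential : is_exponential ex)
  (act_smooth : smooth_action act)
  (act_transitive : transitive_action act)
  (act_effective : almost_effective act)
  (act_w : preserves_form act w)
  (act_J : preserves_endo act J)
  (* the point x, its isotropy K, and the splitting g = k + m *)
  (x : M)
  (K_compact : compact (isotropy act x))
  (k m : {vspace 'rV[R]_r})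
  (k_lie : forall X, X \in k <-> forall t : R, isotropy act x (ex (t *: X)))
  (km_sum : (k + m)%VS = fullv)
  (km_direct : (k :&: m)%VS = 0%VS)
  (m_Ad : forall a X, isotropy act x a -> X \in m -> Ad a X \in m)
  (* the complex structure H transported from J_x *)
  (H : {linear 'rV[R]_r -> 'rV[R]_r})
  (H_k : forall X, X \in k -> H X = 0)
  (H_m : forall X, X \in m -> H X \in m)
  (H_J : forall X, X \in m ->
    fundamental_field act ex (H X) x = J x (fundamental_field act ex X x))
  (* a symplectic basis and an orthonormal basis of m *)
  (f : (n + n).-tuple 'rV[R]_r)
  (f_basis : basis_of m f)
  (f_symplectic : forall i j : 'I_(n + n), (i < j)%N ->
    pullback_form act ex w x (tnth f i) (tnth f j)
      = (val j == val i + n)%N%:R)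
  (e : (n + n).-tuple 'rV[R]_r)
  (e_basis : basis_of m e)
  (e_orthonormal : forall i j : 'I_(n + n),
    pullback_form act ex w x (tnth e i) (H (tnth e j)) = (i == j)%:R)
  (* a point of M and a local orthonormal frame around it *)
  (y : M) (U : set M) (eps : 'I_(n + n) -> M -> 'rV[R]_(n + n))
  (U_open : open U) (U_y : U y)
  (eps_frame : local_orthonormal_frame w J U eps) :
  let inner X Y := pullback_form act ex w x X (H Y) in
  let br_m X Y := daddv_pi m k (lie G X Y) in
  let xi := \sum_(i < n) lie G (tnth f (lshift n i)) (tnth f (rshift n i)) in
  nijenhuis_norm2 w J eps y =
      8^-1 * \sum_(i < n + n) \sum_(j < n + n)
        inner (br_m (tnth e i) (tnth e j)) (br_m (tnth e i) (tnth e j))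
    + 4^-1 * \sum_(i < n + n)
        endo_trace (fun Z => lie G (tnth e i) (lie G (tnth e i) Z))
    - 2^-1 * endo_trace (fun Z => H (lie G xi Z)).
Proof.
move=> inner br_m xi.
(* Writing y as a x gives access to the formula at the group element a, whose right-hand side does
   not involve a; this is the constancy of |N|^2. *)
have [a ax] := act_transitive x y.
have pE X Y : pullback_form act ex w x X Y =
    w x (tmap (act^~ x) (lone G) X) (tmap (act^~ x) (lone G) Y).
  by rewrite /pullback_form !(fundamental_fieldE ex_exponential act_smooth).
have fm i : tnth f i \in m by rewrite -(span_basis f_basis) memv_span// mem_tnth.
have sl Y : scalar ((pullback_form act ex w x)^~ Y).
  by move=> c u v; rewrite !pE linearP linearPl.
have sC X Y : pullback_form act ex w x X Y = - pullback_form act ex w x Y X.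
  exact: form_alternating.
have s0 X : pullback_form act ex w x X X = 0.
  by have [_ alt _ _] := w_symplectic; exact: alt.
pose D := tmap (act^~ x) (lone G).
have f_expand X : X \in m -> X = \sum_(l < n)
    (w x (D X) (D (tnth f (rshift n l))) *: tnth f (lshift n l)
     - w x (D X) (D (tnth f (lshift n l))) *: tnth f (rshift n l)).
  move=> Xm; rewrite {1}(symplectic_basis_expand sl sC s0 f_basis f_symplectic Xm).
  by apply: eq_bigr => l _; rewrite !pE.
rewrite -ax in U_y *.
have := nijenhuis_formula w_symplectic J_almost_complex wJ_compatible
  ex_exponential act_smooth act_w act_J k_lie km_sum km_direct m_Ad H_k H_m H_J
  e_basis e_orthonormal (fun l => fm (lshift n l)) (fun l => fm (rshift n l))
  f_expand U_open U_y eps_frame.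
move=> ->; congr (_ * _ + _ - _).
by apply: eq_bigr => i _; apply: eq_bigr => j _; rewrite /inner pE.
Qed.
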